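(* A minimal primary decomposition of the ideal $J = J(1,d)$ of $R$ is $$ \begin{aligned} J ={}& (s_1-sc_1,\ f_1-sc_4,\ c_1,\ c_2,\ c_3,\ c_4)\\ &\cap \bigcap_{\alpha} \left(s_1-sc_1,\ f_1-sc_4,\ c_4-c_1,\ c_3-c_2,\ c_1-c_2b_1^d,\ s-fb_1^d,\ b_1-b_4,\ b_2-b_3,\ b_1^i-\alpha b_2^i\right)\\ &\cap (s_1-sc_1,\ f_1-sc_4,\ s,\ f)\\ &\cap (s_1-sc_1,\ f_1-sc_4,\ s,\ c_1,\ c_2,\ c_4,\ b_3^d,\ b_4)\\ &\cap (s_1-sc_1,\ f_1-sc_4,\ s,\ c_1,\ c_4,\ b_3^d,\ b_2-b_3,\ c_2b_1-c_3b_4)\\ &\cap \left(s_1-sc_1,\ f_1-sc_4,\ s^2,\ f^2,\ c_4(s-fb_4^d),\ c_3(s-fb_3^d),\ sc_3-fc_4,\ c_3^2,\ c_4^2,\ c_1-c_4,\ c_2-c_3,\ b_2-b_3,\ b_1-b_4\right), \end{aligned} $$ where $\alpha$ varies over the $\frac{d}{i}$th roots of unity in $K$.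
   Context: Let $K$ be a field and $d$ a positive integer. If the characteristic of $K$ is a positive prime $p$, write $d = d'i$, where $i$ is a power of $p$ (possibly $i=1$) and $d'$ and $p$ are relatively prime; if the characteristic of $K$ is zero, let $d'=d$ and $i=1$. Assume that $K$ contains all the $\frac{d}{i}$th roots of unity (so there are $d'$ of them in $K$). Let $R = K[s,f,s_1,f_1,c_1,c_2,c_3,c_4,b_1,b_2,b_3,b_4]$ be the polynomial ring in these $12$ indeterminates. The first Mayr-Meyer ideal is the ideal of $R$ $$ J(1,d) = (s_1-sc_1,\ f_1-sc_4) + \left(c_j(s-fb_j^d) \mid j=1,2,3,4\right) + \left(fc_1-sc_2,\ fc_4-sc_3,\ s(c_3-c_2),\ f(c_2b_1-c_3b_4),\ fc_2(b_2-b_3)\right). $$ A minimal primary decomposition is one in which every listed ideal is primary, the radicals are pairwise distinct, and no component may be omitted. *)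

(* Defs.v *)
From mathcomp Require Import all_boot all_order all_algebra.
From mathcomp.multinomials Require Import mpoly.

Set Implicit Arguments.
Unset Strict Implicit.
Unset Printing Implicit Defensive.

Import GRing.Theory.
Local Open Scope ring_scope.

(* Ideals are Prop-valued predicates: the boolean ideals of ring_quotient
   would require ideal membership to be decidable. *)
Definition is_ideal (R : comNzRingType) (I : R -> Prop) : Prop :=
  [/\ I 0, (forall x y, I x -> I y -> I (x + y))
         & (forall a x, I x -> I (a * x))].

Definition ideal_gen (R : comNzRingType) (gs : seq R) (x : R) : Prop :=
  exists a : 'I_(size gs) -> R, x = \sum_(k < size gs) a k * gs`_k.

Definition radical (R : comNzRingType) (I : R -> Prop) (x : R) : Prop :=
  exists n : nat, I (x ^+ n.+1).

Definition primary_ideal (R : comNzRingType) (I : R -> Prop) : Prop :=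
  [/\ is_ideal I, ~ I 1
    & forall x y, I (x * y) -> I x \/ exists n : nat, I (y ^+ n.+1)].

Definition minimal_primary_decomposition (R : comNzRingType) (J : R -> Prop)
    (Qs : seq (R -> Prop)) : Prop :=
  let Q := tnth (in_tuple Qs) in
  [/\ forall k, primary_ideal (Q k),
      forall x, J x <-> (forall k, Q k x),
      forall k l, k != l -> ~ (forall x, radical (Q k) x <-> radical (Q l) x)
    & forall k, ~ (forall x, J x <-> (forall l, l != k -> Q l x))].

(* d = d' i where i is the p-part of d, p being the characteristic exponent
   of K; [pchar K] is the set of prime p such that p = 0 in K. *)
Definition char_factorization (K : fieldType) (d d' i : nat) : Prop :=
  (forall p : nat, p \in [pchar K] ->
     [/\ d = (d' * i)%N, exists e : nat, i = (p ^ e)%N & coprime d' p]) /\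
  ([pchar K] =i pred0 -> d' = d /\ i = 1%N).

Local Notation X k := ('X_(@Ordinal 12 k isT)).
Local Notation s := (X 0).
Local Notation f := (X 1).
Local Notation s1 := (X 2).
Local Notation f1 := (X 3).
Local Notation c1 := (X 4).
Local Notation c2 := (X 5).
Local Notation c3 := (X 6).
Local Notation c4 := (X 7).
Local Notation b1 := (X 8).
Local Notation b2 := (X 9).
Local Notation b3 := (X 10).
Local Notation b4 := (X 11).

Definition mayr_meyer_gens (K : fieldType) (d : nat) : seq {mpoly K[12]} :=
  [:: s1 - s * c1; f1 - s * c4]
  ++ [:: c1 * (s - f * b1 ^+ d); c2 * (s - f * b2 ^+ d);
         c3 * (s - f * b3 ^+ d); c4 * (s - f * b4 ^+ d)]
  ++ [:: f * c1 - s * c2; f * c4 - s * c3; s * (c3 - c2);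
         f * (c2 * b1 - c3 * b4); f * c2 * (b2 - b3)].

Definition mayr_meyer_ideal (K : fieldType) (d : nat) :
    {mpoly K[12]} -> Prop :=
  ideal_gen (mayr_meyer_gens K d).

Definition comp_c (K : fieldType) : {mpoly K[12]} -> Prop :=
  ideal_gen [:: s1 - s * c1; f1 - s * c4; c1; c2; c3; c4].

Definition comp_alpha (K : fieldType) (d i : nat) (alpha : K) :
    {mpoly K[12]} -> Prop :=
  ideal_gen [:: s1 - s * c1; f1 - s * c4; c4 - c1; c3 - c2;
                c1 - c2 * b1 ^+ d; s - f * b1 ^+ d; b1 - b4; b2 - b3;
                b1 ^+ i - alpha *: b2 ^+ i].

Definition comp_sf (K : fieldType) : {mpoly K[12]} -> Prop :=
  ideal_gen [:: s1 - s * c1; f1 - s * c4; s; f].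

Definition comp_b4 (K : fieldType) (d : nat) : {mpoly K[12]} -> Prop :=
  ideal_gen [:: s1 - s * c1; f1 - s * c4; s; c1; c2; c4; b3 ^+ d; b4].

Definition comp_cb (K : fieldType) (d : nat) : {mpoly K[12]} -> Prop :=
  ideal_gen [:: s1 - s * c1; f1 - s * c4; s; c1; c4; b3 ^+ d; b2 - b3;
                c2 * b1 - c3 * b4].

Definition comp_embedded (K : fieldType) (d : nat) : {mpoly K[12]} -> Prop :=
  ideal_gen [:: s1 - s * c1; f1 - s * c4; s ^+ 2; f ^+ 2;
                c4 * (s - f * b4 ^+ d); c3 * (s - f * b3 ^+ d);
                s * c3 - f * c4; c3 ^+ 2; c4 ^+ 2; c1 - c4; c2 - c3;
                b2 - b3; b1 - b4].

Definition mayr_meyer_components (K : fieldType) (d i : nat)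
    (alphas : seq K) : seq ({mpoly K[12]} -> Prop) :=
  @comp_c K :: [seq comp_alpha d i alpha | alpha <- alphas]
  ++ [:: @comp_sf K; @comp_b4 K d; @comp_cb K d; @comp_embedded K d].

(* Main.v *)
Require Import Defs.
From HB Require Import structures.
From mathcomp Require Import all_boot all_order all_algebra all_field.
From mathcomp.multinomials Require Import mpoly.
From mathcomp Require Import ring.
Import GRing.Theory.
Local Open Scope ring_scope.
Set Implicit Arguments.
Unset Strict Implicit.
Unset Printing Implicit Defensive.

(** Write u_j for b_j^d. The generators s1 - s c1 and f1 - s c4, common to all the
    ideals, only eliminate s1 and f1. Modulo the remaining ones s c_j is
    f c_j u_j, so in positive degree in (s, f) and in (c) the quotient by J is
    generated by f c2 and f c3, and the proof follows an element through the
    module that these two generate.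

    Each component is the inverse image, under a substitution which eliminates
    variables ([ideal_gen_substE]), of an ideal known to be primary. For (c) and
    (s, f) this is zero. For three families it is P + (pi^m) with P and P + (pi)
    prime, which is primary ([primary_adjoin_expn]): P = 0 and pi = b3; P = 0
    and pi = b1 - g b2 with g^i = alpha, where pi^i = b1^i - alpha b2^i by
    Frobenius ([comp_alpha_primary]); P = (c2 b1 - c3 b4) and pi = b3. The last
    P is prime as the kernel of a homomorphism to a field ([minor_prime]). For
    the embedded component the quotient is free over K[b1, b2] on 1, s, f, c3,
    c4, s f, c3 c4, f c3; the coordinates are combinations of partial
    derivatives at s = f = c3 = c4 = 0 ([comp_embeddedE]), and the Leibniz rule
    shows that an element with nonzero constant coordinate is not a zero divisor
    ([emb_kernel_primary]).

    That every component contains J is a verification on generators. Conversely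
    let x be in all the components ([intersection_sub]). Being in (c) and (s, f)
    it is f c2 y + f c3 z modulo J ([reduce_c_sf]). Each further component Q
    then restricts the coefficient: a factor which does not vanish at some zero
    of Q can be cancelled ([primary_cancel]), so the coefficient is in Q; for the
    embedded component it is in the radical, which is the annihilator of f c2
    ([comp_embedded_fc2]). The generators of these ideals carry f c3 or f c2
    into smaller ideals modulo J. This gives in turn f c2 y ([reduce_b4]), f c2 u2 y ([reduce_cb]) and
    f c2 u2 (f y1 + c2 y2) ([reduce_emb]). Finally f y1 + c2 y2 is in all the
    components indexed by roots of unity; after their linear relations are used
    it is a multiple of the product of the b1^i - alpha b2^i
    ([alpha_common_multiple]), which is u1 - u2 because the alpha are the
    d' simple roots of X^d' - 1 ([prod_unity_roots_homog]), and
    f c2 u2 (u1 - u2) (f, c2) is contained in J ([J_fc2_f], [J_fc2_c2]).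

    Both the distinctness of the radicals and irredundancy come from explicit
    elements lying in all components but one ([separator],
    [minimal_primary_of_separating]). *)

(** * Ideals as predicates *)

Section Ideals.
Variable R : comNzRingType.
Implicit Types (I P : R -> Prop) (x y a : R) (gs : seq R).

Fixpoint all_in P gs : Prop := if gs is g :: gs' then P g /\ all_in P gs' else True.

Lemma all_inP P gs : all_in P gs <-> forall k : 'I_(size gs), P gs`_k.
Proof.
elim: gs => [|g gs IH] /=; first by split=> // _ [].
split=> [[Pg /IH Pgs] k | Pgs].
  by case: (unliftP ord0 k) => [j ->|-> //]; exact: Pgs.
by split; [exact: (Pgs ord0) | apply/IH => k; have := Pgs (lift ord0 k)].
Qed.

Section IdealOps.
Variables (I : R -> Prop) (idI : is_ideal I).

Lemma ideal0 : I 0. Proof. by case: idI. Qed.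
Lemma idealD x y : I x -> I y -> I (x + y).
Proof. by case: idI => _ addI _; apply: addI. Qed.
Lemma ideal_mull a x : I x -> I (a * x).
Proof. by case: idI => _ _ mulI; apply: mulI. Qed.
Lemma ideal_mulr a x : I x -> I (x * a).
Proof. by rewrite mulrC; apply: ideal_mull. Qed.
Lemma idealB x y : I x -> I y -> I (x - y).
Proof. by move=> Ix Iy; rewrite -mulN1r; apply: idealD => //; apply: ideal_mull. Qed.

(** Membership by certificate: the list pairs cofactors with known members, so
    that only a polynomial identity remains. *)
Lemma ideal_comb (l : seq (R * R)) x :
  all_in I (unzip2 l) -> x = \sum_(t <- l) t.1 * t.2 -> I x.
Proof.
move=> + ->; elim: l => [|[a g] l IH] /=; first by rewrite big_nil => _; apply: ideal0.
by case=> Ig /IH Il; rewrite big_cons; apply: idealD => //; apply: ideal_mull.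
Qed.

Lemma ideal_exprB x y n : I (x - y) -> I (x ^+ n - y ^+ n).
Proof. by rewrite subrXX; apply: ideal_mulr. Qed.

Lemma ideal_iffB x y : I (x - y) -> I x <-> I y.
Proof.
move=> Ixy; split=> [Ix | Iy]; first by rewrite -[y](subKr x); apply: idealB.
by rewrite -[x](subrK y); apply: idealD.
Qed.
End IdealOps.

Lemma ideal_gen_ideal gs : is_ideal (ideal_gen gs).
Proof.
split.
- by exists (fun => 0); rewrite big1 // => k _; rewrite mul0r.
- move=> x y [a ->] [b ->]; exists (fun k => a k + b k).
  by rewrite -big_split; apply: eq_bigr => k _; rewrite mulrDl.
- move=> c x [a ->]; exists (fun k => c * a k).
  by rewrite mulr_sumr; apply: eq_bigr => k _; rewrite mulrA.
Qed.

Lemma ideal_gen_sub I gs x : is_ideal I -> all_in I gs -> ideal_gen gs x -> I x.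
Proof.
move=> idI /all_inP Igs [a ->].
elim/big_ind: _ => [|u v Iu Iv|k _]; first exact: ideal0.
  exact: idealD.
exact: ideal_mull.
Qed.

Lemma ideal_gen_gens gs : all_in (ideal_gen gs) gs.
Proof.
apply/all_inP => k; exists (fun l => (l == k)%:R).
rewrite (bigD1 k) //= eqxx mul1r big1 ?addr0 // => l /negbTE ->.
by rewrite mul0r.
Qed.

(** * Prime and primary ideals *)

Definition prime_ideal I : Prop :=
  [/\ is_ideal I, ~ I 1 & forall x y, I (x * y) -> I x \/ I y].

Definition zero_ideal x : Prop := x = 0.

(** The ideal I + (a). *)
Definition adjoin I a x : Prop := exists q, I (x - q * a).

Lemma zero_is_ideal : is_ideal zero_ideal.
Proof. by split=> [//|x y -> ->|a x ->]; rewrite /zero_ideal ?addr0 ?mulr0. Qed.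

Lemma adjoin_is_ideal I a : is_ideal I -> is_ideal (adjoin I a).
Proof.
move=> idI; split=> [|x y [p Ix] [q Iy]|b x [q Ix]].
- by exists 0; rewrite mul0r subr0; apply: ideal0.
- exists (p + q); apply: (ideal_comb idI (l := [:: (1, _); (1, _)])).
    by split; [exact: Ix|split; [exact: Iy|]].
  by rewrite !(big_cons, big_nil) /=; ring.
- exists (b * q); apply: (ideal_comb idI (l := [:: (b, _)])); first by split; first exact: Ix.
  by rewrite !(big_cons, big_nil) /=; ring.
Qed.

Lemma prime_ext I P : (forall x, I x <-> P x) -> prime_ideal I -> prime_ideal P.
Proof.
move=> eqIP [[I0 ID IM] I1 Imul]; split; [split|..].
- exact/eqIP.
- by move=> x y /eqIP Ix /eqIP Iy; apply/eqIP; apply: ID.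
- by move=> a x /eqIP Ix; apply/eqIP; apply: IM.
- by move/eqIP.
- by move=> x y /eqIP /Imul [] ?; [left|right]; apply/eqIP.
Qed.

Lemma primary_ext I P : (forall x, I x <-> P x) -> primary_ideal I -> primary_ideal P.
Proof.
move=> eqIP [[I0 ID IM] I1 Imul]; split; [split|..].
- exact/eqIP.
- by move=> x y /eqIP Ix /eqIP Iy; apply/eqIP; apply: ID.
- by move=> a x /eqIP Ix; apply/eqIP; apply: IM.
- by move/eqIP.
- move=> x y /eqIP /Imul [Ix|[n Iy]]; [left|right; exists n]; exact/eqIP.
Qed.

Lemma prime_primary P : prime_ideal P -> primary_ideal P.
Proof.
by case=> idP P1 mulP; split=> // x y /mulP [?|?]; [left|right; exists 0%N].
Qed.

(** In the domain R / P the element pi generates a prime ideal, so a factor y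
    of a multiple of pi^d that is prime to pi leaves all d powers of pi to the
    other factor. *)
Lemma primary_adjoin_expn P pi d : prime_ideal P -> ~ P pi ->
  prime_ideal (adjoin P pi) -> (0 < d)%N -> primary_ideal (adjoin P (pi ^+ d)).
Proof.
move=> [idP P1 mulP] Ppi [idPpi Ppi1 mulPpi] d_gt0.
split; first exact: adjoin_is_ideal.
  case=> q Pq; apply: Ppi1; exists (q * pi ^+ d.-1).
  by rewrite -mulrA -exprSr prednK.
move=> x y [w Pxy].
have step k : (k <= d)%N -> adjoin P pi y \/ adjoin P (pi ^+ k) x.
  elim: k => [|k IH] le_kd.
    by right; exists x; rewrite expr0 mulr1 subrr; apply: ideal0.
  case: (IH (ltnW le_kd)) => [|[z Pz]]; first by left.
  have : P (pi ^+ k * (z * y - w * pi ^+ (d - k))).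
    apply: (ideal_comb idP (l := [:: (1, _); (- y, _)])).
      by split; [exact: Pxy|split; [exact: Pz|]].
    have -> : pi ^+ d = pi ^+ (d - k) * pi ^+ k by rewrite -exprD subnK // ltnW.
    by rewrite !(big_cons, big_nil) /=; ring.
  have Ppik : ~ P (pi ^+ k).
    by elim: (k) => [|m IHm] //; rewrite exprS => /mulP [].
  case/mulP => // Pzy.
  have : adjoin P pi (z * y).
    by exists (w * pi ^+ (d - k).-1); rewrite -mulrA -exprSr prednK // subn_gt0.
  case/mulPpi => [[t Pt]|]; [right|by left].
  exists t; apply: (ideal_comb idP (l := [:: (1, _); (pi ^+ k, _)])).
    by split; [exact: Pz|split; [exact: Pt|]].
  by rewrite !(big_cons, big_nil) /= exprS; ring.
case: (step d (leqnn d)) => [[q Pq]|]; [right|by left].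
exists d.-1; rewrite prednK //; exists (q ^+ d).
by rewrite -exprMn; apply: ideal_exprB.
Qed.

End Ideals.

Lemma zero_prime (R : idomainType) : prime_ideal (@zero_ideal R).
Proof.
split; first exact: zero_is_ideal.
  by move/eqP; rewrite oner_eq0.
by move=> x y /eqP; rewrite mulf_eq0 => /orP[]/eqP; [left|right].
Qed.

Section Preimage.
Variables (R S : comNzRingType) (phi : {rmorphism R -> S}) (I : S -> Prop).

Lemma preim_is_ideal : is_ideal I -> is_ideal (I \o phi).
Proof.
move=> idI; split=> [|x y|a x] /=; first by rewrite rmorph0; apply: ideal0.
  by rewrite rmorphD; apply: idealD.
by rewrite rmorphM; apply: ideal_mull.
Qed.

Lemma preim_prime : prime_ideal I -> prime_ideal (I \o phi).
Proof.
move=> [idI I1 mulI]; split=> [||x y] /=; first exact: preim_is_ideal.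
  by rewrite rmorph1.
by rewrite rmorphM; apply: mulI.
Qed.

Lemma preim_primary : primary_ideal I -> primary_ideal (I \o phi).
Proof.
move=> [idI I1 mulI]; split=> [||x y] /=; first exact: preim_is_ideal.
  by rewrite rmorph1.
by rewrite rmorphM => /mulI [Ix|[n Iy]]; [left|right; exists n; rewrite /= rmorphXn].
Qed.
End Preimage.

(** * Minimality from separating elements *)

(** Of two distinct components at most one is the exceptional e, so the
    separator of the other is in one of the two radicals and not in the other.
    For irredundancy a separator only has to avoid its own component, and this
    is all that can be asked at e when it is embedded, its radical containing
    that of another component. *)
Lemma minimal_primary_of_separating (R : comNzRingType) (L : eqType) (e : L)
    (ls : seq L) (J : R -> Prop) (Q : L -> R -> Prop) (sep : L -> R) :
  uniq ls ->
  {in ls, forall l, primary_ideal (Q l)} ->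
  (forall x, J x <-> {in ls, forall l, Q l x}) ->
  {in ls &, forall l m, l != m -> Q m (sep l)} ->
  {in ls, forall l, ~ Q l (sep l)} ->
  {in ls, forall l, l != e -> ~ radical (Q l) (sep l)} ->
  minimal_primary_decomposition J [seq Q l | l <- ls].
Proof.
move=> uls Qprim JQ sepQ nsepQ nsepR.
rewrite /minimal_primary_decomposition; set Qs := map Q ls.
pose lab (k : 'I_(size Qs)) := nth e ls k.
have lt_ls (k : 'I_(size Qs)) : (k < size ls)%N by rewrite -(size_map Q).
have labP k : lab k \in ls by rewrite mem_nth.
have QlabE k : tnth (in_tuple Qs) k = Q (lab k).
  by rewrite (tnth_nth (Q e)) /= (nth_map e).
have lab_inj k l : k != l -> lab k != lab l by rewrite /lab nth_uniq.
have labW l : l \in ls -> exists k, l = lab k.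
  move=> ll; have lt_l : (index l ls < size Qs)%N by rewrite size_map index_mem.
  by exists (Ordinal lt_l); rewrite /lab /= nth_index.
split=> [k|x|k l neq_kl|k].
- by rewrite QlabE; apply: Qprim.
- rewrite JQ; split=> [Qx k|Qx l /labW [k ->]]; first by rewrite QlabE; apply: Qx.
  by rewrite -QlabE.
- have rad_sep i j : i != j -> radical (Q (lab j)) (sep (lab i)).
    by move=> neq_ij; exists 0%N; apply: sepQ => //; apply: lab_inj.
  rewrite !QlabE => eq_rad; have [ke|] := eqVneq (lab k) e.
    apply: (@nsepR (lab l)) => //; last by apply/eq_rad; rewrite eq_sym in neq_kl; exact: rad_sep.
    by rewrite -ke eq_sym; apply: lab_inj.
  by move/(nsepR _ (labP k)); apply; apply/eq_rad; exact: rad_sep.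
- move=> eqJ; have /JQ/(_ _ (labP k)) : J (sep (lab k)); last exact: nsepQ.
  apply/eqJ => l neq_lk; rewrite QlabE; apply: sepQ => //.
  by apply: lab_inj; rewrite eq_sym.
Qed.

(** * Substitutions in polynomial rings *)

Section Substitution.
Variables (K : fieldType) (n : nat).
Implicit Types (x y : {mpoly K[n]}) (v : n.-tuple {mpoly K[n]}).

Lemma mpoly_ring_ind (P : {mpoly K[n]} -> Prop) :
  (forall c, P c%:MP) -> (forall k, P 'X_k) ->
  (forall x y, P x -> P y -> P (x + y)) ->
  (forall x y, P x -> P y -> P (x * y)) -> forall x, P x.
Proof.
move=> PC PX PD PM x; rewrite [x]mpolyE.
apply: big_ind => [||m _]; [exact: (PC 0)|exact: PD|].
rewrite -mul_mpolyC; apply: (PM) => //; rewrite mpolyXE_id.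
apply: big_ind => [||k _]; [exact: (PC 1)|exact: PM|].
by elim: (m k) => [|j IH]; [exact: (PC 1)|rewrite exprS; apply: PM].
Qed.

Definition subst v : {mpoly K[n]} -> {mpoly K[n]} := comp_mpoly v.
HB.instance Definition _ v := GRing.RMorphism.on (subst v).

Lemma substX v k : subst v 'X_k = v`_k.
Proof. exact: comp_mpolyXU. Qed.

Lemma substC v c : subst v c%:MP = c%:MP.
Proof. exact: comp_mpolyC. Qed.

Lemma subst_comp (u v w : n.-tuple {mpoly K[n]}) :
  (forall k : 'I_n, subst u v`_k = w`_k) -> forall x, subst u (subst v x) = subst w x.
Proof.
move=> uvw; elim/mpoly_ring_ind=> [c|k|x y IHx IHy|x y IHx IHy].
- by rewrite !substC.
- by rewrite !substX.
- by rewrite !rmorphD /= IHx IHy.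
- by rewrite !rmorphM /= IHx IHy.
Qed.

(** Being congruent to one's image under a substitution, even after
    multiplication by e, need only be tested on the variables. *)
Lemma subst_congr (I : {mpoly K[n]} -> Prop) e v : is_ideal I ->
  (forall k : 'I_n, I (e * ('X_k - v`_k))) -> forall x, I (e * (x - subst v x)).
Proof.
move=> idI IX; elim/mpoly_ring_ind=> [c|k|x y IHx IHy|x y IHx IHy].
- by rewrite substC subrr mulr0; apply: ideal0.
- by rewrite substX.
- apply: (ideal_comb idI (l := [:: (1, _); (1, _)])).
    by split; [exact: IHx|split; [exact: IHy|]].
  by rewrite !(big_cons, big_nil) rmorphD /=; ring.
- apply: (ideal_comb idI (l := [:: (y, _); (subst v x, _)])).
    by split; [exact: IHx|split; [exact: IHy|]].
  by rewrite !(big_cons, big_nil) rmorphM /=; ring.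
Qed.

(** When modulo Q every polynomial is congruent to its image under a
    substitution, membership in Q can be read off that image. *)
Lemma ideal_gen_substE gs (I : {mpoly K[n]} -> Prop) v : is_ideal I ->
  (forall k : 'I_n, ideal_gen gs ('X_k - v`_k)) ->
  all_in (I \o subst v) gs ->
  (forall x, I (subst v x) -> ideal_gen gs (subst v x)) ->
  forall x, ideal_gen gs x <-> I (subst v x).
Proof.
move=> idI QX Igs IQ x; split; first exact: ideal_gen_sub (preim_is_ideal _ idI) Igs.
move/IQ => Qvx; have idQ := ideal_gen_ideal gs.
suff cong : ideal_gen gs (1 * (x - subst v x)).
  by apply/(ideal_iffB idQ (y := subst v x)) => //; rewrite -[_ - _]mul1r.
by apply: subst_congr => // k; rewrite mul1r.
Qed.

(** If pi generates the kernel of a substitution that respects P, then P + (pi)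
    is the inverse image of P. *)
Lemma primary_adjoin_subst P v pi d : prime_ideal P -> ~ P pi ->
  P (subst v pi) -> (forall x, P x -> P (subst v x)) ->
  (forall k : 'I_n, adjoin P pi ('X_k - v`_k)) ->
  (0 < d)%N -> primary_ideal (adjoin P (pi ^+ d)).
Proof.
move=> primeP Ppi vpi Pv vX d_gt0; have [idP _ _] := primeP.
apply: primary_adjoin_expn => //.
apply: prime_ext (preim_prime (subst v) primeP) => x /=.
have idPpi := adjoin_is_ideal pi idP.
have cong : adjoin P pi (x - subst v x).
  rewrite -[X in adjoin _ _ X]mul1r; apply: subst_congr => // k.
  by rewrite mul1r.
split=> [Pvx|[q /Pv]].
  apply/(ideal_iffB idPpi cong); exists 0.
  by rewrite mul0r subr0.
rewrite rmorphB rmorphM /= => Pq.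
rewrite -[subst v x](subrK (subst v q * subst v pi)).
by apply: (idealD idP) => //; apply: ideal_mull.
Qed.

Lemma radical_gen_meval gs (p : 'I_n -> K) x :
  all_in (fun g => g.@[p] = 0) gs -> radical (ideal_gen gs) x -> x.@[p] = 0.
Proof.
move=> gs0 [m] Qxm.
have /= := ideal_gen_sub (preim_is_ideal (meval p) (zero_is_ideal K)) gs0 Qxm.
by move/eqP; rewrite rmorphXn expf_eq0 => /andP[_ /eqP].
Qed.

(** A factor that does not vanish at some zero of the ideal is outside the
    radical, hence can be cancelled. *)
Lemma primary_cancel (Q : {mpoly K[n]} -> Prop) (p : 'I_n -> K) a x :
  primary_ideal Q -> (forall y, radical Q y -> y.@[p] = 0) -> a.@[p] != 0 ->
  Q (a * x) -> Q x.
Proof.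
move=> [_ _ mulQ] Q0 /eqP ap; rewrite mulrC => /mulQ[//|rad_a].
by case: ap; apply: Q0.
Qed.

End Substitution.

(** * The ring of the ideal *)

Local Notation var k := ('X_(@Ordinal 12 k isT)).
Local Notation s := (var 0).
Local Notation f := (var 1).
Local Notation s1 := (var 2).
Local Notation f1 := (var 3).
Local Notation c1 := (var 4).
Local Notation c2 := (var 5).
Local Notation c3 := (var 6).
Local Notation c4 := (var 7).
Local Notation b1 := (var 8).
Local Notation b2 := (var 9).
Local Notation b3 := (var 10).
Local Notation b4 := (var 11).

Lemma ord12_ind (P : 'I_12 -> Prop) :
  P (@Ordinal 12 0 isT) -> P (@Ordinal 12 1 isT) -> P (@Ordinal 12 2 isT) ->
  P (@Ordinal 12 3 isT) -> P (@Ordinal 12 4 isT) -> P (@Ordinal 12 5 isT) ->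
  P (@Ordinal 12 6 isT) -> P (@Ordinal 12 7 isT) -> P (@Ordinal 12 8 isT) ->
  P (@Ordinal 12 9 isT) -> P (@Ordinal 12 10 isT) -> P (@Ordinal 12 11 isT) ->
  forall k, P k.
Proof.
move=> P0 P1 P2 P3 P4 P5 P6 P7 P8 P9 P10 P11 [m lt_m].
by do 12?[case: m lt_m => [|m] lt_m; first by rewrite (bool_irrelevance lt_m isT)].
Qed.

Local Ltac subst_simp :=
  rewrite /= ?(rmorphB, rmorphD, rmorphN, rmorphM, rmorphXn, rmorph1, rmorph0) /=
    ?substX ?substC ?mevalXU /=.

Local Ltac conj_split := rewrite /=; repeat match goal with |- _ /\ _ => split end.

Local Ltac comb_ring := rewrite !(big_cons, big_nil) /=; ring.

Local Ltac in_ideal idQ :=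
  first [ assumption | apply: (ideal_mulr idQ); in_ideal idQ
        | apply: (ideal_mull idQ); in_ideal idQ | apply: (idealB idQ); in_ideal idQ ].

(** * The determinantal prime *)

Section Determinantal.
Variable K : fieldType.
Implicit Types x y : {mpoly K[12]}.

Definition minor : {mpoly K[12]} := c2 * b1 - c3 * b4.

(** The generic point of the hypersurface c2 b1 = c3 b4, where b1 is the
    fraction c3 b4 / c2. *)
Definition generic_coord (k : 'I_12) : {fraction {mpoly K[12]}} :=
  if val k == 8 then tofrac (c3 * b4) / tofrac c2 else tofrac 'X_k.

Definition generic_eval : {mpoly K[12]} -> {fraction {mpoly K[12]}} :=
  mmap (@tofrac {mpoly K[12]} \o @mpolyC 12 K) generic_coord.
HB.instance Definition _ := GRing.RMorphism.on generic_eval.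

Lemma generic_evalX k : generic_eval 'X_k = generic_coord k.
Proof. by rewrite /generic_eval mmapX mmap1U. Qed.

Lemma generic_evalC c : generic_eval c%:MP = tofrac c%:MP.
Proof. by rewrite /generic_eval mmapC. Qed.

Definition drop_b1 : 12.-tuple {mpoly K[12]} :=
  [tuple of [:: s; f; s1; f1; c1; c2; c3; c4; 0; b2; b3; b4]].

Lemma generic_eval_drop x : generic_eval (subst drop_b1 x) = tofrac (subst drop_b1 x).
Proof.
elim/mpoly_ring_ind: x => [c|k|x y IHx IHy|x y IHx IHy].
- by rewrite substC generic_evalC.
- rewrite substX; elim/ord12_ind: k; rewrite /= ?generic_evalX //.
  by rewrite !rmorph0.
- by rewrite !rmorphD /= IHx IHy.
- by rewrite !rmorphM /= IHx IHy.
Qed.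

(** Multiplication by a power of c2 lets the relation c2 b1 = c3 b4 remove b1. *)
Lemma clear_b1 x : exists N y,
  adjoin (@zero_ideal _) minor (c2 ^+ N * x - y) /\ subst drop_b1 y = y.
Proof.
have idm := adjoin_is_ideal minor (zero_is_ideal {mpoly K[12]}).
elim/mpoly_ring_ind: x => [c|k|x y|x y].
- exists 0%N, c%:MP; rewrite expr0 mul1r subrr substC.
  by split=> //; apply: ideal0.
- have same z : subst drop_b1 z = z -> exists N y,
      adjoin (@zero_ideal _) minor (c2 ^+ N * z - y) /\ subst drop_b1 y = y.
    by move=> zz; exists 0%N, z; rewrite expr0 mul1r subrr; split=> //; apply: ideal0.
  elim/ord12_ind: k; try by apply: same; rewrite substX.
  exists 1%N, (c3 * b4); split; last by subst_simp.
  by exists 1; rewrite /zero_ideal /minor expr1; ring.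
- move=> [N [x' [Ix xx]]] [M [y' [Iy yy]]].
  exists (N + M)%N, (c2 ^+ M * x' + c2 ^+ N * y').
  split; last by subst_simp; rewrite xx yy.
  apply: (ideal_comb idm (l := [:: (c2 ^+ M, _); (c2 ^+ N, _)])).
    by split; [exact: Ix|split; [exact: Iy|]].
  by rewrite exprD; comb_ring.
- move=> [N [x' [Ix xx]]] [M [y' [Iy yy]]].
  exists (N + M)%N, (x' * y').
  split; last by subst_simp; rewrite xx yy.
  apply: (ideal_comb idm (l := [:: (c2 ^+ M * y, _); (x', _)])).
    by split; [exact: Ix|split; [exact: Iy|]].
  by rewrite exprD; comb_ring.
Qed.

Lemma mpolyX_neq0 (k : 'I_12) : 'X_k != 0 :> {mpoly K[12]}.
Proof.
by apply/eqP => /(congr1 (mcoeff U_(k))) /eqP; rewrite mcoeffXU eqxx mcoeff0 oner_eq0.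
Qed.

(** The variable c2 is prime and does not divide the minor, so it can be
    cancelled from multiples of the minor. *)
Lemma minor_cancel_c2 N x :
  adjoin (@zero_ideal _) minor (c2 ^+ N * x) -> adjoin (@zero_ideal _) minor x.
Proof.
elim: N x => [x|N IH x]; first by rewrite expr0 mul1r.
rewrite exprSr -mulrA => /IH[q /subr0_eq eq_q].
pose v := [tuple of [:: s; f; s1; f1; c1; 0; c3; c4; b1; b2; b3; b4]] : 12.-tuple {mpoly K[12]}.
have /eqP : subst v q * (c3 * b4) = 0.
  have := congr1 (subst v) eq_q; rewrite /minor; subst_simp.
  by rewrite !mul0r sub0r mulrN => /esym/eqP; rewrite oppr_eq0 => /eqP.
rewrite !mulf_eq0 !(negbTE (mpolyX_neq0 _)) !orbF => /eqP vq0.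
have [r /subr0_eq eq_r] : adjoin (@zero_ideal _) c2 q.
  have idc := adjoin_is_ideal c2 (zero_is_ideal {mpoly K[12]}).
  rewrite -[q]subr0 -vq0 -[X in adjoin _ _ X]mul1r; apply: subst_congr => // k.
  rewrite mul1r; elim/ord12_ind: k; rewrite /= ?subrr; try exact: (ideal0 idc).
  by exists 1; rewrite /zero_ideal; ring.
exists r; apply/eqP; rewrite subr_eq0; apply/eqP/(mulfI (mpolyX_neq0 (@Ordinal 12 5 isT))).
by rewrite eq_q eq_r; ring.
Qed.

(** The multiples of the minor are the polynomials vanishing at the generic
    point, the kernel of a homomorphism to a field. *)
Lemma minor_prime : prime_ideal (adjoin (@zero_ideal _) minor).
Proof.
apply: prime_ext (preim_prime generic_eval (zero_prime _)) => x /=.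
have cc : tofrac (c2 : {mpoly K[12]}) != 0 by rewrite tofrac_eq0 mpolyX_neq0.
have minor0 : generic_eval minor = 0.
  rewrite /minor rmorphB !rmorphM /= !generic_evalX /generic_coord /=.
  by rewrite mulrC divfK // rmorphM /= subrr.
rewrite /zero_ideal; split=> [x0|[q /subr0_eq ->]]; last by rewrite rmorphM /= minor0 mulr0.
have [N [y [[q /subr0_eq eq_q] yy]]] := clear_b1 x.
have : generic_eval y = 0.
  rewrite -[y](subKr (c2 ^+ N * x)) eq_q rmorphB !rmorphM /= minor0 x0.
  by rewrite !mulr0 subrr.
rewrite -yy generic_eval_drop yy => /eqP; rewrite tofrac_eq0 => /eqP y0.
by apply: (@minor_cancel_c2 N); exists q; rewrite -eq_q y0 subr0 subrr.
Qed.

End Determinantal.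

(** * The embedded component *)

Section Socle.
Variables (A : comNzRingType) (u v : A).

(** The coefficient of f c3 in a s c3 + b f c3 + c f c4 + e s c4, once s c3,
    f c4 and s c4 are rewritten as v f c3, v f c3 and u v f c3. *)
Definition socle (a b c e : A) : A := v * a + b + v * c + u * v * e.

Lemma socle0 : socle 0 0 0 0 = 0. Proof. by rewrite /socle; ring. Qed.

Lemma socleD a b c e a' b' c' e' :
  socle (a + a') (b + b') (c + c') (e + e') = socle a b c e + socle a' b' c' e'.
Proof. by rewrite /socle; ring. Qed.

Lemma socleM t a b c e : socle (t * a) (t * b) (t * c) (t * e) = t * socle a b c e.
Proof. by rewrite /socle; ring. Qed.

End Socle.

(** Second order jets over a homomorphism eps, known only through the Leibniz
    rule: abstract functions keep the computations below fast. *)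
Section Jets.
Variables (R : comNzRingType) (A : idomainType) (u v : A) (eps : {rmorphism R -> A}).
Variables (jet1 : 'I_4 -> R -> A) (jet2 : 'I_4 -> 'I_4 -> R -> A).

Local Notation "'jet_ k" := (jet1 (@Ordinal 4 k isT)) (at level 0, k at level 8).
Local Notation "'jet_ ( k , l )" := (jet2 (@Ordinal 4 k isT) (@Ordinal 4 l isT))
  (at level 0).

(** The coordinates of x in the basis 1, s, f, c3, c4, s f, c3 c4, f c3 of the
    quotient by the component, the jets being the values at s = f = c3 = c4 = 0
    of partial derivatives with respect to s, f, c3, c4 in this order. *)
Definition emb_coords (x : R) : seq A :=
  [:: eps x; 'jet_0 x; 'jet_1 x; 'jet_2 x; 'jet_3 x; 'jet_(0, 1) x; 'jet_(2, 3) x;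
      socle u v ('jet_(0, 2) x) ('jet_(1, 2) x) ('jet_(1, 3) x) ('jet_(0, 3) x)].

Definition emb_kernel (x : R) : Prop := all_in (@zero_ideal _) (emb_coords x).

Hypothesis jet1D : forall k x y, jet1 k (x + y) = jet1 k x + jet1 k y.
Hypothesis jet2D : forall k l x y, jet2 k l (x + y) = jet2 k l x + jet2 k l y.
Hypothesis jet1M : forall k x y, jet1 k (x * y) = eps x * jet1 k y + eps y * jet1 k x.
Hypothesis jet2M : forall k l x y, jet2 k l (x * y) =
  eps x * jet2 k l y + eps y * jet2 k l x + (jet1 k x * jet1 l y + jet1 l x * jet1 k y).

Lemma jet10 k : jet1 k 0 = 0.
Proof. by apply: (addIr (jet1 k 0)); rewrite -jet1D !add0r. Qed.

Lemma jet20 k l : jet2 k l 0 = 0.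
Proof. by apply: (addIr (jet2 k l 0)); rewrite -jet2D !add0r. Qed.

Lemma jet1N k x : jet1 k (- x) = - jet1 k x.
Proof. by apply: (addIr (jet1 k x)); rewrite -jet1D !addNr jet10. Qed.

Lemma jet2N k l x : jet2 k l (- x) = - jet2 k l x.
Proof. by apply: (addIr (jet2 k l x)); rewrite -jet2D !addNr jet20. Qed.

Lemma emb_kernel_ideal : is_ideal emb_kernel.
Proof.
split; rewrite /emb_kernel /zero_ideal /=.
- by rewrite rmorph0 !jet10 !jet20 socle0.
- move=> x y [x0 [xs [xf [x3 [x4 [xsf [x34 [xw _]]]]]]]].
  move=> [y0 [ys [yf [y3 [y4 [ysf [y34 [yw _]]]]]]]].
  rewrite rmorphD !(jet1D, jet2D) /= socleD x0 xs xf x3 x4 xsf x34 xw.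
  by rewrite y0 ys yf y3 y4 ysf y34 yw addr0.
- move=> a x [x0 [xs [xf [x3 [x4 [xsf [x34 [xw _]]]]]]]].
  rewrite rmorphM !(jet1M, jet2M) /= x0 xs xf x3 x4 xsf x34 !(mulr0, mul0r, addr0).
  by rewrite socleM xw mulr0.
Qed.

(** An element with nonzero constant coordinate is not a zero divisor: by the
    Leibniz rule the coordinates of a product are triangular in those of the
    other factor. An element with zero constant coordinate is nilpotent, a
    product of three such having no terms of order two. *)
Lemma emb_kernel_primary : primary_ideal emb_kernel.
Proof.
split; first exact: emb_kernel_ideal.
  by rewrite /emb_kernel /zero_ideal /= rmorph1 => -[/eqP]; rewrite oner_eq0.
move=> x y; rewrite mulrC; have [y0 _|y0] := eqVneq (eps y) 0.
  right; exists 2%N; rewrite !exprS expr0 mulr1.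
  rewrite /emb_kernel /zero_ideal /= !rmorphM !(jet1M, jet2M, rmorphM) /= y0.
  by rewrite !(mul0r, mulr0, add0r, addr0) socle0.
rewrite /emb_kernel /zero_ideal /= rmorphM !(jet1M, jet2M) /= => xy; left.
have cancel a : eps y * a = 0 -> a = 0.
  by move=> /eqP; rewrite mulf_eq0 (negbTE y0) /= => /eqP.
case: xy => /cancel ->; rewrite !(mul0r, addr0).
move=> [/cancel -> [/cancel -> [/cancel -> [/cancel ->]]]].
rewrite !(mulr0, mul0r, addr0) socleM.
by move=> [/cancel -> [/cancel -> [/cancel ->]]].
Qed.

(** Elements x playing the roles of the variables s, f, c3, c4, and
    coefficients a playing that of polynomials in b1, b2. *)
Section Coordinates.
Variables (x : 'I_4 -> R) (a : nat -> R).
Hypothesis eps_x : forall k, eps (x k) = 0.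
Hypothesis jet1_x : forall k l, jet1 k (x l) = (l == k)%:R.
Hypothesis jet2_x : forall k l m, jet2 k l (x m) = 0.
Hypothesis jet1_a : forall k m, jet1 k (a m) = 0.
Hypothesis jet2_a : forall k l m, jet2 k l (a m) = 0.

Local Notation "'x_ k" := (x (@Ordinal 4 k isT)) (at level 0, k at level 8).

Definition emb_normal : R :=
  a 0 + 'x_0 * a 1 + 'x_1 * a 2 + 'x_2 * a 3 + 'x_3 * a 4
  + 'x_0 * 'x_1 * a 5 + 'x_2 * 'x_3 * a 6 + 'x_1 * 'x_2 * a 7.

Lemma emb_coords_normal : emb_coords emb_normal = [seq eps (a k) | k <- iota 0 8].
Proof.
rewrite /emb_coords /emb_normal.
rewrite !(jet1D, jet2D, rmorphD) !(jet1M, jet2M, rmorphM) /=.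
rewrite !jet2_x !jet1_x !eps_x !jet1_a !jet2_a /=.
by rewrite /socle !(mulr0, mul0r, add0r, addr0, mulr1, mul1r).
Qed.

(** The weights in [socle] are those for which the mixed quadratic generators
    have last coordinate zero. *)
Lemma emb_kernel_gens (U V : R) : eps U = u -> eps V = v ->
  (forall k, jet1 k U = 0) -> (forall k, jet1 k V = 0) ->
  (forall k l, jet2 k l U = 0) -> (forall k l, jet2 k l V = 0) ->
  all_in emb_kernel [:: 'x_0 ^+ 2; 'x_1 ^+ 2; 'x_3 * ('x_0 - 'x_1 * U);
    'x_2 * ('x_0 - 'x_1 * V); 'x_0 * 'x_2 - 'x_1 * 'x_3; 'x_2 ^+ 2; 'x_3 ^+ 2].
Proof.
move=> epsU epsV jU jV jjU jjV.
have in_kernel g : all_in (@zero_ideal _) (emb_coords g) -> emb_kernel g by [].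
do 7?[split=> //; first (apply: in_kernel;
  rewrite /emb_coords /zero_ideal ?expr2 ?(jet1M, jet2M, jet1D, jet2D, jet1N, jet2N)
    ?(rmorphD, rmorphN, rmorphM) /= ?jet2_x ?jet1_x ?eps_x ?epsU ?epsV ?jU ?jV
    ?jjU ?jjV /=;
  repeat split; rewrite /socle; ring)].
Qed.

Lemma emb_kernel_socle w : emb_kernel ('x_1 * 'x_2 * w) -> eps w = 0.
Proof.
rewrite /emb_kernel /zero_ideal /= => -[_ [_ [_ [_ [_ [_ [_ [+ _]]]]]]]].
rewrite !(jet2M, jet1M) !rmorphM /= !eps_x !jet1_x !jet2_x /socle /=.
by rewrite !(mulr0, mul0r, add0r, addr0, mulr1).
Qed.

End Coordinates.
End Jets.

(** Reduction modulo the radical of the component. *)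
Definition emb_const (K : fieldType) : 12.-tuple {mpoly K[12]} :=
  [tuple of [:: 0; 0; 0; 0; 0; 0; 0; 0; b1; b2; b2; b1]].

(** Eliminates the variables that the linear generators express through
    s, f, c3, c4, b1, b2. *)
Definition emb_elim (K : fieldType) : 12.-tuple {mpoly K[12]} :=
  [tuple of [:: s; f; s * c4; s * c4; c4; c3; c3; c4; b1; b2; b2; b1]].

(** The indices of s, f, c3, c4. *)
Definition emb_index (k : 'I_4) : 'I_12 :=
  nth ord0 [:: @Ordinal 12 0 isT; @Ordinal 12 1 isT; @Ordinal 12 6 isT; @Ordinal 12 7 isT] k.

(** Locked, since unfolding them makes the comparison of two jets expensive. *)
HB.lock Definition emb_jet1 (K : fieldType) (k : 'I_4) (x : {mpoly K[12]}) :
  {mpoly K[12]} := subst (emb_const K) x^`M(emb_index k).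
HB.lock Definition emb_jet2 (K : fieldType) (k l : 'I_4) (x : {mpoly K[12]}) :
  {mpoly K[12]} := subst (emb_const K) x^`M(emb_index k)^`M(emb_index l).

Section EmbeddedComponent.
Variables (K : fieldType) (d : nat).
Implicit Types x y z : {mpoly K[12]}.

Local Notation eps := (subst (emb_const K)).
Local Notation elim := (subst (emb_elim K)).
Local Notation jet1 := (@emb_jet1 K).
Local Notation jet2 := (@emb_jet2 K).

Lemma emb_jet1D k x y : jet1 k (x + y) = jet1 k x + jet1 k y.
Proof. by rewrite emb_jet1.unlock mderivD rmorphD. Qed.

Lemma emb_jet2D k l x y : jet2 k l (x + y) = jet2 k l x + jet2 k l y.
Proof. by rewrite emb_jet2.unlock !mderivD rmorphD. Qed.

Lemma emb_jet1M k x y : jet1 k (x * y) = eps x * jet1 k y + eps y * jet1 k x.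
Proof.
by rewrite emb_jet1.unlock mderivM rmorphD !rmorphM /= addrC; congr (_ + _); rewrite mulrC.
Qed.

Lemma emb_jet2M k l x y : jet2 k l (x * y) =
  eps x * jet2 k l y + eps y * jet2 k l x + (jet1 k x * jet1 l y + jet1 l x * jet1 k y).
Proof.
rewrite emb_jet2.unlock emb_jet1.unlock !(mderivM, mderivD) !(rmorphD, rmorphM) /=.
by move: (eps x) (eps y) (eps _) (eps _) (eps _) (eps _) (eps _) (eps _) => *; ring.
Qed.

Lemma mderivXU (i k : 'I_12) : ('X_k : {mpoly K[12]})^`M(i) = (k == i)%:R.
Proof.
rewrite mderivX mnm1E; case: eqP => [->|_]; last by rewrite scale0r.
by rewrite -{1}[U_(i)%MM]add0m addmK mpolyX0 scale1r.
Qed.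

Lemma emb_index_inj : injective emb_index.
Proof.
by move=> [[|[|[|[|//]]]] ?] [[|[|[|[|//]]]] ?] // _; apply/val_inj.
Qed.

Lemma emb_jet1X k l : jet1 k 'X_(emb_index l) = (l == k)%:R.
Proof. by rewrite emb_jet1.unlock mderivXU rmorph_nat (inj_eq emb_index_inj). Qed.

Lemma emb_jet2X k l m : jet2 k l 'X_(emb_index m) = 0.
Proof. by rewrite emb_jet2.unlock mderivXU -mpolyC_nat mderivC rmorph0. Qed.

Lemma eps_emb_index k : eps 'X_(emb_index k) = 0.
Proof. by rewrite substX; case: k => [[|[|[|[|]]]] ?]. Qed.

Lemma mderiv_eps k x : (eps x)^`M(emb_index k) = 0.
Proof.
elim/mpoly_ring_ind: x => [c|j|x y IHx IHy|x y IHx IHy].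
- by rewrite substC mderivC.
- rewrite substX; case: k => [[|[|[|[|//]]]] ?]; elim/ord12_ind: j;
    by rewrite /= ?mderiv0 // mderivXU.
- by rewrite rmorphD mderivD /= IHx IHy addr0.
- by rewrite rmorphM mderivM /= IHx IHy mul0r mulr0 addr0.
Qed.

Lemma emb_jet1_eps k x : jet1 k (eps x) = 0.
Proof. by rewrite emb_jet1.unlock mderiv_eps rmorph0. Qed.

Lemma emb_jet2_eps k l x : jet2 k l (eps x) = 0.
Proof. by rewrite emb_jet2.unlock mderiv_eps mderiv0 rmorph0. Qed.

Lemma eps_eps x : eps (eps x) = eps x.
Proof. by apply: subst_comp => k; elim/ord12_ind: k; subst_simp. Qed.

Lemma elim_eps x : elim (eps x) = eps x.
Proof. by apply: subst_comp => k; elim/ord12_ind: k; subst_simp. Qed.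

Lemma eps_elim x : eps (elim x) = eps x.
Proof. by apply: subst_comp => k; elim/ord12_ind: k; subst_simp; ring. Qed.

Local Notation coords := (emb_coords (b1 ^+ d) (b2 ^+ d) eps jet1 jet2).
Local Notation kernel := (emb_kernel (b1 ^+ d) (b2 ^+ d) eps jet1 jet2).

Lemma jet_kernel_ideal : is_ideal kernel.
Proof.
by apply: emb_kernel_ideal;
  [exact: emb_jet1D|exact: emb_jet2D|exact: emb_jet1M|exact: emb_jet2M].
Qed.

Lemma jet_kernel_primary : primary_ideal kernel.
Proof.
by apply: emb_kernel_primary;
  [exact: emb_jet1D|exact: emb_jet2D|exact: emb_jet1M|exact: emb_jet2M].
Qed.

Lemma emb_coords_expansion (a : nat -> {mpoly K[12]}) :
  coords (eps (a 0) + s * eps (a 1) + f * eps (a 2) + c3 * eps (a 3) + c4 * eps (a 4)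
    + s * f * eps (a 5) + c3 * c4 * eps (a 6) + f * c3 * eps (a 7))
  = [seq eps (a k) | k <- iota 0 8].
Proof.
have := @emb_coords_normal _ _ (b1 ^+ d) (b2 ^+ d) eps jet1 jet2 emb_jet1D emb_jet2D
  emb_jet1M emb_jet2M (fun k => 'X_(emb_index k)) (fun k => eps (a k)) eps_emb_index
  emb_jet1X emb_jet2X (fun _ _ => emb_jet1_eps _ _) (fun _ _ _ => emb_jet2_eps _ _ _).
rewrite /emb_normal /emb_index /= => ->.
by rewrite !eps_eps.
Qed.

Local Notation Q := (@comp_embedded K d).

Lemma comp_embedded_ideal : is_ideal Q.
Proof. exact: ideal_gen_ideal. Qed.

Lemma comp_embedded_elimX k : Q ('X_k - (emb_elim K)`_k).
Proof.
have idQ := comp_embedded_ideal.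
have [Es1 [Ef1 [_ [_ [_ [_ [_ [_ [_ [Ec1 [Ec2 [Eb3 [Eb4 _]]]]]]]]]]]]] := ideal_gen_gens
  [:: s1 - s * c1; f1 - s * c4; s ^+ 2; f ^+ 2; c4 * (s - f * b4 ^+ d);
      c3 * (s - f * b3 ^+ d); s * c3 - f * c4; c3 ^+ 2; c4 ^+ 2; c1 - c4; c2 - c3;
      b2 - b3; b1 - b4 : {mpoly K[12]}].
elim/ord12_ind: k; rewrite /= ?subrr; try exact: (ideal0 idQ).
- apply: (ideal_comb idQ (l := [:: (1, _); (s, _)])).
    by split; [exact: Es1|split; [exact: Ec1|]].
  by comb_ring.
- exact: Ef1.
- exact: Ec1.
- exact: Ec2.
- by rewrite -opprB -mulN1r; apply: ideal_mull => //; exact: Eb3.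
- by rewrite -opprB -mulN1r; apply: ideal_mull => //; exact: Eb4.
Qed.

Lemma jet1_pow k (j : 'I_12) : (emb_const K)`_j = 'X_j -> jet1 k ('X_j ^+ d) = 0.
Proof.
move=> jj; have -> : 'X_j = eps 'X_j by rewrite substX.
by rewrite -rmorphXn emb_jet1_eps.
Qed.

Lemma jet2_pow k l (j : 'I_12) : (emb_const K)`_j = 'X_j -> jet2 k l ('X_j ^+ d) = 0.
Proof.
move=> jj; have -> : 'X_j = eps 'X_j by rewrite substX.
by rewrite -rmorphXn emb_jet2_eps.
Qed.

Lemma comp_embedded_sub (P : {mpoly K[12]} -> Prop) : is_ideal P ->
  all_in P [:: s ^+ 2; f ^+ 2; c4 * (s - f * b1 ^+ d); c3 * (s - f * b2 ^+ d);
    s * c3 - f * c4; c3 ^+ 2; c4 ^+ 2] -> forall x, Q x -> P (elim x).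
Proof.
move=> idP [Ess [Eff [E4 [E3 [Esc [E33 [E44 _]]]]]]] x.
have P0 : P 0 by exact: ideal0.
apply: ideal_gen_sub (preim_is_ideal elim idP) _.
by do 13?[split; first by subst_simp; rewrite ?subrr].
Qed.

Lemma comp_embedded_kernel x : Q x -> kernel (elim x).
Proof.
move: x; apply: comp_embedded_sub; first exact: jet_kernel_ideal.
have := @emb_kernel_gens _ _ (b1 ^+ d) (b2 ^+ d) eps jet1 jet2 emb_jet1D emb_jet2D
  emb_jet1M emb_jet2M (fun k => 'X_(emb_index k)) eps_emb_index
  emb_jet1X emb_jet2X (b1 ^+ d) (b2 ^+ d).
rewrite rmorphXn /= substX => /(_ erefl); rewrite rmorphXn /= substX => /(_ erefl).
move=> /(_ (fun k => @jet1_pow k (@Ordinal 12 8 isT) erefl)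
  (fun k => @jet1_pow k (@Ordinal 12 9 isT) erefl)).
move=> /(_ (fun k l => @jet2_pow k l (@Ordinal 12 8 isT) erefl)
  (fun k l => @jet2_pow k l (@Ordinal 12 9 isT) erefl)).
exact.
Qed.

(** The span over K[b1, b2] of 1, s, f, c3, c4, s f, c3 c4, f c3 modulo Q. *)
Definition emb_span x : Prop := exists a : nat -> {mpoly K[12]},
  Q (x - (eps (a 0) + s * eps (a 1) + f * eps (a 2) + c3 * eps (a 3) + c4 * eps (a 4)
    + s * f * eps (a 5) + c3 * c4 * eps (a 6) + f * c3 * eps (a 7))).

Lemma emb_spanD x y : emb_span x -> emb_span y -> emb_span (x + y).
Proof.
have idQ := comp_embedded_ideal.
move=> [a Qx] [b Qy]; exists (fun k => a k + b k).
apply: (ideal_comb idQ (l := [:: (1, _); (1, _)])).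
  by split; [exact: Qx|split; [exact: Qy|]].
rewrite !rmorphD !(big_cons, big_nil) /=.
move: (eps (a 0)) (eps (a 1)) (eps (a 2)) (eps (a 3)) (eps (a 4)) (eps (a 5)) (eps (a 6)).
move: (eps (a 7)) (eps (b 0)) (eps (b 1)) (eps (b 2)) (eps (b 3)) (eps (b 4)) (eps (b 5)).
by move: (eps (b 6)) (eps (b 7)) => *; ring.
Qed.

Lemma emb_span_congr x y : Q (y - x) -> emb_span x -> emb_span y.
Proof.
have idQ := comp_embedded_ideal.
move=> Qyx [a Qx]; exists a; apply: (ideal_comb idQ (l := [:: (1, _); (1, _)])).
  by split; [exact: Qyx|split; [exact: Qx|]].
by comb_ring.
Qed.

Lemma emb_span_basis z : all_in emb_span
  [seq e * eps z | e <- [:: 1; s; f; c3; c4; s * f; c3 * c4; f * c3]].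
Proof.
have idQ := comp_embedded_ideal.
have base (k : nat) e : Q (e * eps z - (let a (i : nat) := if i == k then z else 0 in
    eps (a 0) + s * eps (a 1) + f * eps (a 2) + c3 * eps (a 3) + c4 * eps (a 4)
    + s * f * eps (a 5) + c3 * c4 * eps (a 6) + f * c3 * eps (a 7))) -> emb_span (e * eps z).
  by move=> Qe; exists (fun i => if i == k then z else 0).
rewrite /=; do ?split=> //;
  [apply: (base 0)|apply: (base 1)|apply: (base 2)|apply: (base 3)|apply: (base 4)
  |apply: (base 5)|apply: (base 6)|apply: (base 7)];
  by rewrite /= !rmorph0 !(mulr0, add0r, addr0, mul1r) subrr; apply: ideal0.
Qed.

(** First order Taylor expansion along the radical of the component. *)
Lemma emb_taylor x : exists q : nat -> {mpoly K[12]},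
  Q (x - (eps x + s * q 0 + f * q 1 + c3 * q 2 + c4 * q 3)).
Proof.
have idQ := comp_embedded_ideal.
pose I y := exists q : nat -> {mpoly K[12]}, Q (y - (s * q 0 + f * q 1 + c3 * q 2 + c4 * q 3)).
have idI : is_ideal I.
  split=> [|y z [p Qy] [q Qz]|a y [q Qy]].
  - by exists (fun=> 0); rewrite !mulr0 !addr0 subrr; apply: ideal0.
  - exists (fun k => p k + q k); apply: (ideal_comb idQ (l := [:: (1, _); (1, _)])).
      by split; [exact: Qy|split; [exact: Qz|]].
    by comb_ring.
  - exists (fun k => a * q k); apply: (ideal_comb idQ (l := [:: (a, _)])).
      by split; [exact: Qy|].
    by comb_ring.
have I1 : all_in I [:: s; f; c3; c4].
  do ?[split=> //]; [exists (fun k => (k == 0%N)%:R)|exists (fun k => (k == 1%N)%:R)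
  |exists (fun k => (k == 2%N)%:R)|exists (fun k => (k == 3%N)%:R)];
  by rewrite /= !(mulr0, mulr1, addr0, add0r) subrr; apply: ideal0.
have QI y : Q y -> I y by exists (fun=> 0); rewrite !mulr0 !addr0 subr0.
have [Is [If [I3 [I4 _]]]] := I1.
have : I (1 * (x - eps x)).
  apply: subst_congr => // k; rewrite mul1r.
  rewrite -[_ - _](subrKA (emb_elim K)`_k); apply: idealD => //.
    exact/QI/comp_embedded_elimX.
  elim/ord12_ind: k; rewrite /= ?subrr ?subr0; try exact: (ideal0 idI); try by [];
    by apply: ideal_mull.
rewrite mul1r => -[q Qq]; exists q.
by rewrite -!addrA opprD !addrA.
Qed.

Lemma emb_span_expand e : (forall z, emb_span (e * eps z)) ->
  all_in (fun v => forall z, emb_span (e * v * z)) [:: s; f; c3; c4] ->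
  forall x, emb_span (e * x).
Proof.
have idQ := comp_embedded_ideal.
move=> E0 [Es [Ef [E3 [E4 _]]]] x; have [q Qx] := emb_taylor x.
apply: (@emb_span_congr (e * eps x + e * s * q 0 + e * f * q 1 + e * c3 * q 2 + e * c4 * q 3)).
  apply: (ideal_comb idQ (l := [:: (e, _)])); first by split; [exact: Qx|].
  by comb_ring.
by do !apply: emb_spanD.
Qed.

Lemma emb_spanT x : emb_span x.
Proof.
have idQ := comp_embedded_ideal.
have [_ [_ [Ess [Eff [E4 [E3 [Esc [E33 [E44 _]]]]]]]]] := ideal_gen_gens
  [:: s1 - s * c1; f1 - s * c4; s ^+ 2; f ^+ 2; c4 * (s - f * b4 ^+ d);
      c3 * (s - f * b3 ^+ d); s * c3 - f * c4; c3 ^+ 2; c4 ^+ 2; c1 - c4; c2 - c3;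
      b2 - b3; b1 - b4 : {mpoly K[12]}].
have spanQ y z : Q y -> emb_span (y * z).
  move=> Qy; apply: (@emb_span_congr (1 * eps 0)); last by case: (emb_span_basis 0).
  by rewrite rmorph0 mulr0 subr0; apply: ideal_mulr.
(* relations of degree two, then products of degree three, which all vanish *)
have Q3 : Q (s * c3 - f * c3 * b3 ^+ d).
  by apply: (ideal_comb idQ (l := [:: (1, _)])); [split; [exact: E3|]|comb_ring].
have Qf4 : Q (f * c4 - f * c3 * b3 ^+ d).
  apply: (ideal_comb idQ (l := [:: (1, _); (-1, _)])).
    by split; [exact: Q3|split; [exact: Esc|]].
  by comb_ring.
have Qs4 : Q (s * c4 - f * c3 * (b3 ^+ d * b4 ^+ d)).
  apply: (ideal_comb idQ (l := [:: (1, _); (b4 ^+ d, _)])).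
    by split; [exact: E4|split; [exact: Qf4|]].
  by comb_ring.
have Qsf3 : Q (s * f * c3).
  apply: (ideal_comb idQ (l := [:: (f, _); (c3 * b3 ^+ d, _)])).
    by split; [exact: E3|split; [exact: Eff|]].
  by comb_ring.
have Qsf4 : Q (s * f * c4).
  apply: (ideal_comb idQ (l := [:: (f, _); (c4 * b4 ^+ d, _)])).
    by split; [exact: E4|split; [exact: Eff|]].
  by comb_ring.
have Q34s : Q (s * c3 * c4).
  apply: (ideal_comb idQ (l := [:: (c4, _); (f, _)])).
    by split; [exact: Esc|split; [exact: E44|]].
  by comb_ring.
have Q34f : Q (f * c3 * c4).
  apply: (ideal_comb idQ (l := [:: (- c3, _); (s, _)])).
    by split; [exact: Esc|split; [exact: E33|]].
  by comb_ring.
have basis z := emb_span_basis z.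
have Sf z : emb_span (s * f * z).
  apply: emb_span_expand z => [z|]; first by case: (basis z) => [_ [_ [_ [_ [_ []]]]]].
  conj_split=> //= z; apply: spanQ => //.
  - by rewrite mulrAC -expr2; apply: ideal_mulr.
  - by rewrite -mulrA -expr2; apply: ideal_mull.
have S34 z : emb_span (c3 * c4 * z).
  apply: emb_span_expand z => [z|]; first by case: (basis z) => [_ [_ [_ [_ [_ [_ []]]]]]].
  conj_split=> //= z; apply: spanQ => //.
  - by rewrite -mulrC mulrA.
  - by rewrite -mulrC mulrA.
  - by rewrite mulrAC -expr2; apply: ideal_mulr.
  - by rewrite -mulrA -expr2; apply: ideal_mull.
have Sf3 z : emb_span (f * c3 * z).
  apply: emb_span_expand z => [z|]; first by case: (basis z) => [_ [_ [_ [_ [_ [_ [_ []]]]]]]].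
  conj_split=> //= z; apply: spanQ => //.
  - by rewrite -mulrC mulrA.
  - by rewrite mulrAC -expr2; apply: ideal_mulr.
  - by rewrite -mulrA -expr2; apply: ideal_mull.
have Ss3 z : emb_span (s * c3 * z).
  apply: emb_span_congr (Sf3 (b3 ^+ d * z)); rewrite mulrA -mulrBl.
  exact: ideal_mulr.
have Sf4 z : emb_span (f * c4 * z).
  apply: emb_span_congr (Sf3 (b3 ^+ d * z)); rewrite mulrA -mulrBl.
  exact: ideal_mulr.
have Ss4 z : emb_span (s * c4 * z).
  apply: emb_span_congr (Sf3 (b3 ^+ d * b4 ^+ d * z)); rewrite mulrA -mulrBl.
  exact: ideal_mulr.
have Ls z : emb_span (s * z).
  apply: emb_span_expand z => [z|]; first by case: (basis z) => [_ []].
  by conj_split=> //= z; rewrite -expr2; apply: spanQ.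
have Lf z : emb_span (f * z).
  apply: emb_span_expand z => [z|]; first by case: (basis z) => [_ [_ []]].
  conj_split=> //= z; first by rewrite [f * s]mulrC.
  by rewrite -expr2; apply: spanQ.
have L3 z : emb_span (c3 * z).
  apply: emb_span_expand z => [z|]; first by case: (basis z) => [_ [_ [_ []]]].
  conj_split=> //= z; rewrite 1?[c3 * s]mulrC 1?[c3 * f]mulrC //.
  by rewrite -expr2; apply: spanQ.
have L4 z : emb_span (c4 * z).
  apply: emb_span_expand z => [z|]; first by case: (basis z) => [_ [_ [_ [_ []]]]].
  conj_split=> //= z; rewrite 1?[c4 * s]mulrC 1?[c4 * f]mulrC 1?[c4 * c3]mulrC //.
  by rewrite -expr2; apply: spanQ.
rewrite -[x]mul1r; apply: emb_span_expand => [z|]; first by case: (basis z).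
by conj_split=> //= z; rewrite mul1r.
Qed.

(** The eight coordinates detect membership: they vanish on the component, and
    modulo it every polynomial is the combination of the basis with these
    coordinates. *)
Lemma comp_embeddedE x : Q x <-> kernel (elim x).
Proof.
have [idQ idk] := (comp_embedded_ideal, jet_kernel_ideal).
apply: (ideal_gen_substE idk comp_embedded_elimX).
  apply/all_inP => k; apply: comp_embedded_kernel.
  by have /all_inP Qg : all_in Q _ := @ideal_gen_gens _ _; exact: Qg.
move=> {}x; set y := subst _ x => ky.
have yy : elim y = y.
  by apply: subst_comp => k; elim/ord12_ind: k; subst_simp.
have [a Qa] := emb_spanT y; set n := (X in y - X) in Qa.
have nn : elim n = n by rewrite /n !rmorphD !rmorphM /= !elim_eps !substX.
have kn : kernel n.
  have := comp_embedded_kernel Qa; rewrite rmorphB /= yy nn => kyn.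
  by rewrite -[n](subKr y); apply: idealB.
suff n0 : n = 0 by move: Qa; rewrite n0 subr0.
move: kn; rewrite /emb_kernel emb_coords_expansion /zero_ideal /=.
by move=> [a0 [a1 [a2 [a3 [a4 [a5 [a6 [a7 _]]]]]]]]; rewrite /n a0 a1 a2 a3 a4 a5 a6 a7
  !mulr0 !addr0.
Qed.

Lemma comp_embedded_primary : primary_ideal Q.
Proof.
apply: primary_ext (preim_primary elim jet_kernel_primary) => x.
by apply: iff_sym; exact: comp_embeddedE.
Qed.

(** Modulo the component f c2 is the basis element f c3, which is annihilated by
    s, f, c3 and c4: its annihilator is the radical. *)
Lemma comp_embedded_fc2 x : Q (f * c2 * x) -> eps x = 0.
Proof.
move/comp_embeddedE; rewrite !rmorphM /= !substX /= => k.
have := @emb_kernel_socle _ _ (b1 ^+ d) (b2 ^+ d) eps jet1 jet2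
  emb_jet1M emb_jet2M (fun k => 'X_(emb_index k)) eps_emb_index
  emb_jet1X emb_jet2X (elim x) k.
by rewrite /= eps_elim.
Qed.

End EmbeddedComponent.

(** * The other components *)

Section Components.
Variables (K : fieldType) (d : nat).
Implicit Types x y z : {mpoly K[12]}.

Local Notation zeroP := (@zero_ideal {mpoly K[12]}).
Let zero_idealP : is_ideal zeroP := zero_is_ideal _.

Lemma adjoin_sub (I P : {mpoly K[12]} -> Prop) a x : is_ideal P ->
  (forall y, I y -> P y) -> P a -> adjoin I a x -> P x.
Proof.
by move=> idP IP Pa [q /IP Pq]; rewrite -[x](subrK (q * a)); apply: idealD => //; apply: ideal_mull.
Qed.

Lemma zero_sub (P : {mpoly K[12]} -> Prop) x : is_ideal P -> zeroP x -> P x.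
Proof. by move=> idP ->; apply: ideal0. Qed.

Lemma adjoin_gen (I : {mpoly K[12]} -> Prop) a : is_ideal I -> adjoin I a a.
Proof. by move=> idI; exists 1; rewrite mul1r subrr; apply: ideal0. Qed.

Lemma adjoin_incl (I : {mpoly K[12]} -> Prop) a x : I x -> adjoin I a x.
Proof. by move=> Ix; exists 0; rewrite mul0r subr0. Qed.

Definition c_elim : 12.-tuple {mpoly K[12]} :=
  [tuple of [:: s; f; 0; 0; 0; 0; 0; 0; b1; b2; b3; b4]].

(** After elimination of s1 and f1 by substitution the components of (c) and
    (s, f) are generated by variables, hence are kernels of substitutions. *)
Lemma comp_c_primary : primary_ideal (@comp_c K).
Proof.
have idQ : is_ideal (@comp_c K) := @ideal_gen_ideal _ _.
have G : all_in (@comp_c K) _ := @ideal_gen_gens _ _.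
move: (G) => /= [G1 [G2 [G3 [G4 [G5 [G6 _]]]]]].
apply: primary_ext (prime_primary (preim_prime (subst c_elim) (zero_prime _))) => x /=.
apply: iff_sym; apply: ideal_gen_substE x => [//|k||x].
- elim/ord12_ind: k; rewrite /= ?subrr ?subr0; try exact: (ideal0 idQ); try by [].
  + apply: (ideal_comb idQ (l := [:: (1, _); (s, _)])).
      by split; [exact: G1|split; [exact: G3|]].
    by comb_ring.
  + apply: (ideal_comb idQ (l := [:: (1, _); (s, _)])).
      by split; [exact: G2|split; [exact: G6|]].
    by comb_ring.
- by subst_simp; do ?[split=> //]; rewrite /zero_ideal ?mulr0 ?subrr.
- exact: zero_sub.
Qed.

Definition sf_elim : 12.-tuple {mpoly K[12]} :=
  [tuple of [:: 0; 0; 0; 0; c1; c2; c3; c4; b1; b2; b3; b4]].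

Lemma comp_sf_primary : primary_ideal (@comp_sf K).
Proof.
have idQ : is_ideal (@comp_sf K) := @ideal_gen_ideal _ _.
have G : all_in (@comp_sf K) _ := @ideal_gen_gens _ _.
move: (G) => /= [G1 [G2 [G3 [G4 _]]]].
apply: primary_ext (prime_primary (preim_prime (subst sf_elim) (zero_prime _))) => x /=.
apply: iff_sym; apply: ideal_gen_substE x => [//|k||x].
- elim/ord12_ind: k; rewrite /= ?subrr ?subr0; try exact: (ideal0 idQ); try by [].
  + apply: (ideal_comb idQ (l := [:: (1, _); (c1, _)])).
      by split; [exact: G1|split; [exact: G3|]].
    by comb_ring.
  + apply: (ideal_comb idQ (l := [:: (1, _); (c4, _)])).
      by split; [exact: G2|split; [exact: G3|]].
    by comb_ring.
- by subst_simp; do ?[split=> //]; rewrite /zero_ideal ?mul0r ?subrr.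
- exact: zero_sub.
Qed.

Hypothesis d_gt0 : (0 < d)%N.

Definition drop_b3 : 12.-tuple {mpoly K[12]} :=
  [tuple of [:: s; f; s1; f1; c1; c2; c3; c4; b1; b2; 0; b4]].

Lemma adjoin_drop_b3 (P : {mpoly K[12]} -> Prop) : is_ideal P ->
  forall k, adjoin P b3 ('X_k - drop_b3`_k).
Proof.
move=> idP k; have idA := adjoin_is_ideal b3 idP.
elim/ord12_ind: k; rewrite /= ?subrr; try exact: (ideal0 idA).
by rewrite subr0; apply: adjoin_gen.
Qed.

Definition b4_elim : 12.-tuple {mpoly K[12]} :=
  [tuple of [:: 0; f; 0; 0; 0; 0; c3; 0; b1; b2; b3; 0]].

(** Substitution leaves the ideal (b3^d), a power of a prime. *)
Lemma comp_b4_primary : primary_ideal (@comp_b4 K d).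
Proof.
have idQ : is_ideal (@comp_b4 K d) := @ideal_gen_ideal _ _.
have G : all_in (@comp_b4 K d) _ := @ideal_gen_gens _ _.
move: (G) => /= [G1 [G2 [G3 [G4 [G5 [G6 [G7 [G8 _]]]]]]]].
have prim : primary_ideal (adjoin zeroP (b3 ^+ d)).
  apply: (primary_adjoin_subst (v := drop_b3)) => //; first exact: zero_prime.
  - by apply/eqP/mpolyX_neq0.
  - by rewrite substX.
  - by move=> x ->; rewrite /zero_ideal rmorph0.
  - exact: adjoin_drop_b3.
apply: primary_ext (preim_primary (subst b4_elim) prim) => x /=.
apply: iff_sym; apply: ideal_gen_substE x => [|k||x].
- exact: adjoin_is_ideal.
- elim/ord12_ind: k; rewrite /= ?subrr ?subr0; try exact: (ideal0 idQ); try by [].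
  + apply: (ideal_comb idQ (l := [:: (1, _); (c1, _)])).
      by split; [exact: G1|split; [exact: G3|]].
    by comb_ring.
  + apply: (ideal_comb idQ (l := [:: (1, _); (c4, _)])).
      by split; [exact: G2|split; [exact: G3|]].
    by comb_ring.
- subst_simp; rewrite !mul0r !subrr.
  by do ?[split=> //; first by [apply: adjoin_gen|apply: adjoin_incl]].
- by apply: adjoin_sub => // y; apply: zero_sub.
Qed.

Definition cb_elim : 12.-tuple {mpoly K[12]} :=
  [tuple of [:: 0; f; 0; 0; 0; c2; c3; 0; b1; b3; b3; b4]].

(** Substitution leaves the determinantal prime with b3^d added. *)
Lemma comp_cb_primary : primary_ideal (@comp_cb K d).
Proof.
have idQ : is_ideal (@comp_cb K d) := @ideal_gen_ideal _ _.
have G : all_in (@comp_cb K d) _ := @ideal_gen_gens _ _.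
move: (G) => /= [G1 [G2 [G3 [G4 [G5 [G6 [G7 [G8 _]]]]]]]].
have idM : is_ideal (adjoin zeroP (minor K)) by exact: adjoin_is_ideal.
have prim : primary_ideal (adjoin (adjoin zeroP (minor K)) (b3 ^+ d)).
  apply: (primary_adjoin_subst (v := drop_b3)) => //; first exact: minor_prime.
  (* the minor vanishes where all variables but b3 are zero, and b3 does not *)
  - case=> q /subr0_eq /(congr1 (meval (fun k => if val k == 10 then 1 else 0))).
    rewrite /minor; subst_simp; rewrite !mul0r subrr mulr0 => /eqP.
    by rewrite oner_eq0.
  - by rewrite substX; apply: ideal0.
  - move=> x [q /subr0_eq ->]; exists (subst drop_b3 q).
    by rewrite /zero_ideal /minor; subst_simp; rewrite subrr.
  - exact: adjoin_drop_b3.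
apply: primary_ext (preim_primary (subst cb_elim) prim) => x /=.
apply: iff_sym; apply: ideal_gen_substE x => [|k||x].
- exact: adjoin_is_ideal.
- elim/ord12_ind: k; rewrite /= ?subrr ?subr0; try exact: (ideal0 idQ); try by [].
  + apply: (ideal_comb idQ (l := [:: (1, _); (c1, _)])).
      by split; [exact: G1|split; [exact: G3|]].
    by comb_ring.
  + apply: (ideal_comb idQ (l := [:: (1, _); (c4, _)])).
      by split; [exact: G2|split; [exact: G3|]].
    by comb_ring.
- subst_simp; rewrite !mul0r !subrr.
  have z0 : adjoin (adjoin zeroP (minor K)) (b3 ^+ d) 0.
    by apply: ideal0; apply: adjoin_is_ideal.
  by do ?split=> //; [apply: adjoin_gen|apply: adjoin_incl; apply: adjoin_gen].
- move=> Ax; apply: (adjoin_sub idQ _ G6 Ax) => y Ay.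
  by apply: (adjoin_sub idQ _ G8 Ay) => z; apply: zero_sub.
Qed.

Definition alpha_elim : 12.-tuple {mpoly K[12]} :=
  [tuple of [:: f * b1 ^+ d; f; f * b1 ^+ d * (c2 * b1 ^+ d);
    f * b1 ^+ d * (c2 * b1 ^+ d); c2 * b1 ^+ d; c2; c2; c2 * b1 ^+ d; b1; b2; b2; b1]].

Lemma comp_alphaE i a x : @comp_alpha K d i a x <->
  adjoin zeroP (b1 ^+ i - a *: b2 ^+ i) (subst alpha_elim x).
Proof.
have idQ : is_ideal (@comp_alpha K d i a) := @ideal_gen_ideal _ _.
have G : all_in (@comp_alpha K d i a) _ := @ideal_gen_gens _ _.
move: (G) => /= [G1 [G2 [G3 [G4 [G5 [G6 [G7 [G8 [G9 _]]]]]]]]].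
apply: ideal_gen_substE x => [|k||x].
- exact: adjoin_is_ideal.
- elim/ord12_ind: k; rewrite /= ?subrr ?subr0; try exact: (ideal0 idQ); try by [].
  + apply: (ideal_comb idQ (l := [:: (1, _); (c1, _); (f * b1 ^+ d, _)])).
      by split; [exact: G1|split; [exact: G6|split; [exact: G5|]]].
    by comb_ring.
  + apply: (ideal_comb idQ (l := [:: (1, _); (s, _); (c1, _); (f * b1 ^+ d, _)])).
      by split; [exact: G2|split; [exact: G3|split; [exact: G6|split; [exact: G5|]]]].
    by comb_ring.
  + apply: (ideal_comb idQ (l := [:: (1, _); (1, _)])).
      by split; [exact: G3|split; [exact: G5|]].
    by comb_ring.
  + apply: (ideal_comb idQ (l := [:: (-1, _)])).
      by split; [exact: G8|].
    by comb_ring.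
  + apply: (ideal_comb idQ (l := [:: (-1, _)])).
      by split; [exact: G7|].
    by comb_ring.
- rewrite -!mul_mpolyC; subst_simp; rewrite !subrr.
  have z0 : adjoin zeroP (b1 ^+ i - a%:MP * b2 ^+ i) 0.
    by apply: ideal0; apply: adjoin_is_ideal.
  by do ?[split=> //]; apply: adjoin_gen.
- by apply: adjoin_sub => // y; apply: zero_sub.
Qed.

(** As i is a power of the characteristic exponent, b1^i - g^i b2^i is the i-th
    power of the linear form b1 - g b2. *)
Lemma comp_alpha_primary i g : (0 < i)%N -> [pchar K].-nat i ->
  primary_ideal (@comp_alpha K d i (g ^+ i)).
Proof.
move=> i_gt0 pi; pose l : {mpoly K[12]} := b1 - g%:MP * b2.
have pi' : [pchar {mpoly K[12]}].-nat i.
  by rewrite (eq_pnat _ (pchar_lalg {mpoly K[12]})).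
have le : l ^+ i = b1 ^+ i - g ^+ i *: b2 ^+ i.
  by rewrite /l exprDn_pchar // exprNn_pchar // exprMn -mul_mpolyC rmorphXn.
pose v : 12.-tuple {mpoly K[12]} :=
  [tuple of [:: s; f; s1; f1; c1; c2; c3; c4; g%:MP * b2; b2; b3; b4]].
have prim : primary_ideal (adjoin zeroP (l ^+ i)).
  apply: (primary_adjoin_subst (v := v)) => //; first exact: zero_prime.
  - move/(congr1 (meval (fun k => if val k == 8 then 1 else 0))).
    rewrite /l; subst_simp; rewrite mulr0 subr0 => /eqP.
    by rewrite oner_eq0.
  - by rewrite /l; subst_simp; rewrite subrr.
  - by move=> x ->; rewrite /zero_ideal rmorph0.
  - move=> k; have idA := adjoin_is_ideal l zero_idealP.
    elim/ord12_ind: k; rewrite /= ?subrr; try exact: (ideal0 idA).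
    exact: adjoin_gen.
apply: primary_ext (preim_primary (subst alpha_elim) prim) => x /=.
by apply: iff_sym; rewrite le; exact: comp_alphaE.
Qed.

End Components.

(** * The intersection of the components *)

Section Colon.
Variables (R : comNzRingType) (I : R -> Prop).

Definition colon e x : Prop := I (e * x).

Lemma colon_is_ideal e : is_ideal I -> is_ideal (colon e).
Proof.
move=> idI; split=> [|x y|a x]; rewrite /colon.
- by rewrite mulr0; apply: ideal0.
- by rewrite mulrDr; apply: idealD.
- by rewrite mulrCA; apply: ideal_mull.
Qed.
End Colon.

Section Relations.
Variables (K : fieldType) (d : nat).
Local Notation J := (@mayr_meyer_ideal K d).
Local Notation u1 := (b1 ^+ d : {mpoly K[12]}).
Local Notation u2 := (b2 ^+ d : {mpoly K[12]}).
Local Notation u3 := (b3 ^+ d : {mpoly K[12]}).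

Local Notation sg := (subst (sf_elim K)).

Lemma J_ideal : is_ideal J. Proof. exact: ideal_gen_ideal. Qed.

Lemma J_gens : all_in J (mayr_meyer_gens K d).
Proof. exact: ideal_gen_gens. Qed.

(** In degree one in s, f and in the c_j everything is generated modulo J by
    f c2 and f c3, as s c_j is f c_j b_j^d; the next lemmas express the other
    f c_j and find the relations between these two generators. *)
Lemma J_fc1 : J (f * c1 - f * c2 * u2).
Proof.
have /= [_ [_ [_ [H2 [_ [_ [A1 _]]]]]]] := J_gens.
apply: (ideal_comb J_ideal (l := [:: (1, _); (1, _)])).
  by split; [exact: A1|split; [exact: H2|]].
by comb_ring.
Qed.

Lemma J_fc4 : J (f * c4 - f * c2 * u2).
Proof.
have /= [_ [_ [_ [H2 [_ [_ [_ [A2 [A3 _]]]]]]]]] := J_gens.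
apply: (ideal_comb J_ideal (l := [:: (1, _); (1, _); (1, _)])).
  by split; [exact: A2|split; [exact: A3|split; [exact: H2|]]].
by comb_ring.
Qed.

Lemma J_fc3 : J (f * c3 * u3 - f * c2 * u2).
Proof.
have /= [_ [_ [_ [H2 [H3 [_ [_ [_ [A3 _]]]]]]]]] := J_gens.
apply: (ideal_comb J_ideal (l := [:: (-1, _); (1, _); (1, _)])).
  by split; [exact: H3|split; [exact: A3|split; [exact: H2|]]].
by comb_ring.
Qed.

Lemma J_fc2_u23 : J (f * c2 * u2 - f * c2 * u3).
Proof.
have /= [_ [_ [_ [_ [_ [_ [_ [_ [_ [_ [A5 _]]]]]]]]]]] := J_gens.
rewrite -mulrBr; apply: (@ideal_exprB _ (colon J (f * c2))) A5.
by apply: colon_is_ideal; exact: J_ideal.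
Qed.

Lemma J_fc2_b14 : J (f * c2 * u2 * (b4 - b1)).
Proof.
have /= [_ [_ [_ [_ [_ [_ [_ [_ [_ [A4 _]]]]]]]]]] := J_gens.
apply: (ideal_comb J_ideal (l := [:: (- b1, _); (- u3, _); (- b4, _)])).
  by split; [exact: J_fc2_u23|split; [exact: A4|split; [exact: J_fc3|]]].
by comb_ring.
Qed.

(** The element f c2 b2^d (b1^d - b2^d) lies in every component but the embedded
    one; multiplied by f or by c2 it enters J. The reason is that s acts on
    f c1 c2 both as f b1^d and as f b2^d, and similarly on f c1. *)
Lemma J_fc2_f : J (f * c2 * u2 * f * (u1 - u2)).
Proof.
have /= [_ [_ [H1 [H2 _]]]] := J_gens.
apply: (ideal_comb J_ideal (l := [:: (s - f * u1, _); (- f, _); (f * u2, _)])).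
  by split; [exact: J_fc1|split; [exact: H1|split; [exact: H2|]]].
by comb_ring.
Qed.

Lemma J_fc2_c2 : J (f * c2 * u2 * c2 * (u1 - u2)).
Proof.
have /= [_ [_ [H1 [H2 _]]]] := J_gens.
apply: (ideal_comb J_ideal (l := [:: (- c2, _); (c1, _); (c2 * (u2 - u1), _)])).
  by split; [exact: H1|split; [exact: H2|split; [exact: J_fc1|]]].
by comb_ring.
Qed.

(** Membership in (c1, c2, c3, c4) and in (s, f), ideals in independent
    variables once s1 and f1 are eliminated, gives membership in their product:
    the cofactor a of each c_j can be replaced with a minus its value at
    s = f = 0. All the products s c_j and f c_j lie in J + (f c2, f c3). *)
Lemma reduce_c_sf x : comp_c x -> comp_sf x ->
  adjoin (adjoin J (f * c2)) (f * c3) x.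
Proof.
have idA := adjoin_is_ideal (f * c2) J_ideal.
have idM := adjoin_is_ideal (f * c3) idA; set M := adjoin _ _ in idM *.
have JM y : J y -> M y by move=> Jy; do 2!apply: adjoin_incl.
have /= [/JM G1 [/JM G2 [/JM H1 [/JM H2 [/JM H3 [/JM H4 _]]]]]] := J_gens.
have Mf2 : M (f * c2) by apply: adjoin_incl; apply: adjoin_gen; exact: J_ideal.
have Mf3 : M (f * c3) by apply: adjoin_gen.
have Mf1 : M (f * c1).
  by apply/(ideal_iffB idM (JM _ J_fc1)); apply: ideal_mulr.
have Mf4 : M (f * c4).
  by apply/(ideal_iffB idM (JM _ J_fc4)); apply: ideal_mulr.
have Ms c b : M (c * (s - f * b)) -> M (f * c) -> M (c * s).
  move=> Mcs Mfc; apply: (ideal_comb idM (l := [:: (1, _); (b, _)])).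
    by split; [exact: Mcs|split; [exact: Mfc|]].
  by comb_ring.
have Mc c : M (f * c) -> M (c * s) -> forall a, M (c * (a - sg a)).
  move=> Mfc Mcs; apply: subst_congr => // k.
  elim/ord12_ind: k; rewrite /= ?subrr ?subr0 ?mulr0; try exact: (ideal0 idM); try by [].
  - by rewrite mulrC.
  - apply: (ideal_comb idM (l := [:: (c, _); (c1, _)])).
      by split; [exact: G1|split; [exact: Mcs|]].
    by comb_ring.
  - apply: (ideal_comb idM (l := [:: (c, _); (c4, _)])).
      by split; [exact: G2|split; [exact: Mcs|]].
    by comb_ring.
pose P y := forall a, M (a * y - sg (a * y)).
have idP : is_ideal P.
  split=> [a|y z Py Pz a|b y Py a].
  - by rewrite mulr0 rmorph0 subrr; apply: ideal0.
  - rewrite mulrDr rmorphD opprD addrACA; exact: idealD.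
  - by rewrite mulrA; apply: Py.
move=> Qc Qsf.
have sg0 : sg x = 0.
  apply: (ideal_gen_sub (preim_is_ideal sg (zero_is_ideal _)) _ Qsf).
  by subst_simp; rewrite !mul0r !subrr.
suff /(_ 1) : P x by rewrite mul1r sg0 subr0.
apply: (ideal_gen_sub idP _ Qc) => /=.
have Pc c : sg c = c -> (forall a, M (c * (a - sg a))) -> P c.
  by move=> cc Mca a; rewrite rmorphM /= cc -mulrBl mulrC; apply: Mca.
have P0 g : sg g = 0 -> M g -> P g.
  by move=> g0 Mg a; rewrite rmorphM /= g0 mulr0 subr0; apply: ideal_mull.
split; first by apply: P0 => //; subst_simp; rewrite mul0r subrr.
split; first by apply: P0 => //; subst_simp; rewrite mul0r subrr.
by split; [|split; [|split; [|split]]] => //; apply: Pc;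
  rewrite ?substX //; apply: Mc => //; apply: Ms; eassumption.
Qed.

(** Every generator of this component times f c3 falls into J + (f c2), because
    modulo J both b4 and b3^d carry f c3 to a multiple of f c2. *)
Lemma reduce_b4 z : comp_b4 d z -> adjoin J (f * c2) (f * c3 * z).
Proof.
have idA := adjoin_is_ideal (f * c2) J_ideal; set A := adjoin _ _ in idA *.
have JA y : J y -> A y by move=> Jy; apply: adjoin_incl.
have /= [/JA G1 [/JA G2 [_ [_ [/JA H3 [_ [_ [_ [_ [/JA A4 _]]]]]]]]]] := J_gens.
have Af2 : A (f * c2) by apply: adjoin_gen; exact: J_ideal.
have Af1 : A (f * c1) by apply/(ideal_iffB idA (JA _ J_fc1)); apply: ideal_mulr.
have Af4 : A (f * c4) by apply/(ideal_iffB idA (JA _ J_fc4)); apply: ideal_mulr.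
have Af3 : A (f * c3 * u3) by apply/(ideal_iffB idA (JA _ J_fc3)); apply: ideal_mulr.
move=> Qz; apply: (@ideal_gen_sub _ (colon A (f * c3)) _ _ _ _ Qz).
  exact: colon_is_ideal.
rewrite /= /colon; split; first exact: ideal_mull.
split; first exact: ideal_mull.
split.
  apply: (ideal_comb idA (l := [:: (f, _); (f, _)])).
    by split; [exact: H3|split; [exact: Af3|]].
  by comb_ring.
split; first by rewrite mulrAC; apply: ideal_mulr.
split; first by rewrite mulrAC; apply: ideal_mulr.
split; first by rewrite mulrAC; apply: ideal_mulr.
split; first by [].
split; last by [].
apply: (ideal_comb idA (l := [:: (-1, _); (b1, _)])).
  by split; [exact: A4|split; [exact: Af2|]].
by comb_ring.
Qed.

(** Every generator of this component times f c2 falls into J + (f c2 b2^d), and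
    b2 - b3 and c2 b1 - c3 b4 even into J. *)
Lemma reduce_cb y : comp_cb d y -> adjoin J (f * c2 * u2) (f * c2 * y).
Proof.
have idB := adjoin_is_ideal (f * c2 * u2) J_ideal; set B := adjoin _ _ in idB *.
have JB z : J z -> B z by move=> Jz; apply: adjoin_incl.
have /= [/JB G1 [/JB G2 [_ [/JB H2 [_ [_ [_ [_ [_ [/JB A4 [/JB A5 _]]]]]]]]]]] := J_gens.
have Bf2 : B (f * c2 * u2) by apply: adjoin_gen; exact: J_ideal.
have Bf1 : B (f * c1) by apply/(ideal_iffB idB (JB _ J_fc1)).
have Bf4 : B (f * c4) by apply/(ideal_iffB idB (JB _ J_fc4)).
move=> Qy; apply: (@ideal_gen_sub _ (colon B (f * c2)) _ _ _ _ Qy).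
  exact: colon_is_ideal.
rewrite /= /colon; split; first exact: ideal_mull.
split; first exact: ideal_mull.
split.
  apply: (ideal_comb idB (l := [:: (f, _); (f, _)])).
    by split; [exact: H2|split; [exact: Bf2|]].
  by comb_ring.
split; first by rewrite mulrAC; apply: ideal_mulr.
split; first by rewrite mulrAC; apply: ideal_mulr.
split; first by apply/(ideal_iffB idB (JB _ J_fc2_u23)).
split; first by [].
split; last by [].
by rewrite mulrAC; apply: ideal_mulr.
Qed.

(** The radical of the embedded component is generated by s1, f1, s, f, the c_j,
    b3 - b2 and b4 - b1; the two differences kill f c2 b2^d modulo J and the
    other generators carry it to multiples of f c2 b2^d f and f c2 b2^d c2. *)
Lemma reduce_emb y : subst (emb_const K) y = 0 ->
  adjoin (adjoin J (f * c2 * u2 * f)) (f * c2 * u2 * c2) (f * c2 * u2 * y).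
Proof.
move=> y0; rewrite -[y]subr0 -y0; set e := f * c2 * u2.
have idA := adjoin_is_ideal (e * f) J_ideal.
have idC := adjoin_is_ideal (e * c2) idA; set C := adjoin _ _ in idC *.
have JC z : J z -> C z by move=> Jz; do 2!apply: adjoin_incl.
have /= [/JC G1 [/JC G2 [_ [/JC H2 [_ [_ [_ [_ [_ [_ [/JC A5 _]]]]]]]]]]] := J_gens.
have Cf : C (e * f) by apply: adjoin_incl; apply: adjoin_gen; exact: J_ideal.
have C2 : C (e * c2) by apply: adjoin_gen.
have Cs : C (e * s).
  apply: (ideal_comb idC (l := [:: (f * u2, _); (u2, _)])).
    by split; [exact: H2|split; [exact: Cf|]].
  by rewrite /e; comb_ring.
apply: subst_congr => // k.
elim/ord12_ind: k; rewrite /= ?subrr ?subr0 ?mulr0; try exact: (ideal0 idC); try by [].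
- apply: (ideal_comb idC (l := [:: (e, _); (c1, _)])).
    by split; [exact: G1|split; [exact: Cs|]].
  by comb_ring.
- apply: (ideal_comb idC (l := [:: (e, _); (c4, _)])).
    by split; [exact: G2|split; [exact: Cs|]].
  by comb_ring.
- apply: (ideal_comb idC (l := [:: (c2 * u2, _); (u2, _)])).
    by split; [exact: (JC _ J_fc1)|split; [exact: C2|]].
  by rewrite /e; comb_ring.
- apply: (ideal_comb idC (l := [:: (c3, _); (c2, _); (1, _)])).
    by split; [exact: (JC _ J_fc2_u23)|split; [exact: (JC _ J_fc3)|split; [exact: C2|]]].
  by rewrite /e; comb_ring.
- apply: (ideal_comb idC (l := [:: (c2 * u2, _); (u2, _)])).
    by split; [exact: (JC _ J_fc4)|split; [exact: C2|]].
  by rewrite /e; comb_ring.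
- apply: (ideal_comb idC (l := [:: (- u2, _)])); first by split; [exact: A5|].
  by rewrite /e; comb_ring.
- by apply: JC; exact: J_fc2_b14.
Qed.

(** Modulo J, polynomials multiplied by f^2 c2 b2^d or f c2^2 b2^d may be
    reduced modulo the linear relations of the components indexed by roots of
    unity. *)
Lemma reduce_alpha e : e = f \/ e = c2 ->
  forall y, J (f * c2 * u2 * e * (y - subst (alpha_elim K d) y)).
Proof.
move=> ee; have idJ := J_ideal; set w := f * c2 * u2.
have /= [G1 [G2 [H1 [H2 [_ [_ [_ [_ [_ [_ [A5 _]]]]]]]]]]] := J_gens.
have D : J (w * e * (u1 - u2)) by case: ee => ->; [exact: J_fc2_f|exact: J_fc2_c2].
have E3 : J (w * e * (c3 - c2)).
  have -> : w * e * (c3 - c2) = e * (w * c3 - w * c2) by ring.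
  apply: ideal_mull => //; apply: (ideal_comb idJ (l := [:: (c3, _); (c2, _)])).
    by split; [exact: J_fc2_u23|split; [exact: J_fc3|]].
  by rewrite /w; comb_ring.
have Es : J (w * e * (s - f * u1)).
  apply: (ideal_comb idJ (l := [:: (f * u2 * e, _); (- f, _)])).
    by split; [exact: H2|split; [exact: D|]].
  by rewrite /w; comb_ring.
have E1 : J (w * e * (c1 - c2 * u1)).
  apply: (ideal_comb idJ (l := [:: (c2 * u2 * e, _); (- c2, _)])).
    by split; [exact: J_fc1|split; [exact: D|]].
  by rewrite /w; comb_ring.
have E4 : J (w * e * (c4 - c2 * u1)).
  apply: (ideal_comb idJ (l := [:: (c2 * u2 * e, _); (- c2, _)])).
    by split; [exact: J_fc4|split; [exact: D|]].
  by rewrite /w; comb_ring.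
apply: subst_congr => // k.
elim/ord12_ind: k; rewrite /= ?subrr ?mulr0; try exact: (ideal0 idJ); try by [].
- apply: (ideal_comb idJ (l := [:: (w * e, _); (c1, _); (f * u1, _)])).
    by split; [exact: G1|split; [exact: Es|split; [exact: E1|]]].
  by comb_ring.
- apply: (ideal_comb idJ (l := [:: (w * e, _); (c4, _); (f * u1, _)])).
    by split; [exact: G2|split; [exact: Es|split; [exact: E4|]]].
  by comb_ring.
- apply: (ideal_comb idJ (l := [:: (- u2 * e, _)])); first by split; [exact: A5|].
  by rewrite /w; comb_ring.
- by rewrite mulrAC; apply: ideal_mulr => //; exact: J_fc2_b14.
Qed.

End Relations.

(** * Roots of unity *)

Section RootsOfUnity.
Variable K : fieldType.

Lemma char_factorizationP d d' i : (0 < d)%N -> char_factorization K d d' i ->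
  [/\ d = (d' * i)%N, coprime i d', d'%:R != 0 :> K & [pchar K].-nat i].
Proof.
move=> d_gt0 [char_p char_0].
have facts p : p \in [pchar K] ->
    [&& d == (d' * i)%N, coprime i d', d'%:R != 0 :> K & [pchar K].-nat i].
  move=> pK; have [-> [e ->] cop] := char_p p pK; have pr_p := pcharf_prime pK.
  rewrite eqxx coprimeXl 1?coprime_sym //=; apply/andP; split.
    by rewrite -(dvdn_pcharf pK) -prime_coprime // coprime_sym.
  by rewrite (eq_pnat _ (pcharf_eq pK)) pnatX pnat_id // orbT.
suff /and4P[/eqP ? ? ? ?] :
    [&& d == (d' * i)%N, coprime i d', d'%:R != 0 :> K & [pchar K].-nat i] by split.
apply: contraT => nfacts.
have no_p : [pchar K] =i pred0.
  by move=> p; apply/negP => /facts; apply/negP.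
have [d'E iE] := char_0 no_p; case/negP: nfacts; rewrite d'E iE muln1 eqxx coprime1n /= andbT.
by apply/negP => /(natf0_pchar d_gt0)[p]; rewrite no_p.
Qed.

Lemma unity_root_exp d' i (a : K) : (0 < i)%N -> coprime i d' -> a ^+ d' = 1 ->
  exists g, g ^+ i = a.
Proof.
move=> i_gt0 cop ad; have [u v uv _] := egcdnP d' i_gt0.
exists (a ^+ u); rewrite -exprM uv (eqP cop) exprD expr1 mulnC exprM ad expr1n.
by rewrite mul1r.
Qed.

(** The polynomial X^d' - 1 is separable, so no factor is repeated. *)
Lemma prod_unity_roots d' (alphas : seq K) : d'%:R != 0 :> K ->
  (exists zs : seq K, 'X^d' - 1 = \prod_(z <- zs) ('X - z%:P)) ->
  uniq alphas -> (forall a, (a \in alphas) = d'.-unity_root a) ->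
  \prod_(a <- alphas) ('X - a%:P) = 'X^d' - 1.
Proof.
move=> d'K [zs Ezs] ua alphasE; rewrite Ezs; apply: perm_big.
have uz : uniq zs by rewrite -separable_prod_XsubC -Ezs separable_Xn_sub_1.
apply: uniq_perm => // a.
by rewrite alphasE /root_of_unity unfold_in Ezs root_prod_XsubC.
Qed.

(** Homogenization of the previous factorization, by evaluation at the
    fraction x / y. *)
Lemma prod_unity_roots_homog n d' (alphas : seq K) (x y : {mpoly K[n]}) :
  (0 < d')%N -> y != 0 ->
  \prod_(a <- alphas) ('X - a%:P) = 'X^d' - 1 ->
  \prod_(a <- alphas) (x - a *: y) = x ^+ d' - y ^+ d'.
Proof.
move=> d'_gt0 y0 Ealphas.
have size_alphas : size alphas = d'.
  by apply: succn_inj; rewrite -(size_prod_XsubC alphas id) Ealphas size_XnsubC.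
pose F := {fraction {mpoly K[n]}}.
pose iota : {rmorphism K -> F} := (@tofrac {mpoly K[n]} \o @mpolyC n K).
pose t : F := tofrac x / tofrac y.
have ty : tofrac y != 0 by rewrite tofrac_eq0.
have : (map_poly iota (\prod_(a <- alphas) ('X - a%:P))).[t] = t ^+ d' - 1.
  by rewrite Ealphas rmorphB /= map_polyXn rmorph1 !hornerE.
rewrite rmorph_prod horner_prod => Et.
apply/eqP; rewrite -tofrac_eq; apply/eqP.
rewrite rmorph_prod rmorphB !rmorphXn /=.
have -> : tofrac x ^+ d' - tofrac y ^+ d' = (t ^+ d' - 1) * tofrac y ^+ d'.
  by rewrite mulrBl mul1r -exprMn /t divfK.
rewrite -Et -[in RHS]size_alphas -[size alphas]count_predT -iter_mulr_1 -big_const_seq.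
rewrite -big_split /=; apply: eq_bigr => a _.
rewrite !rmorphB /= map_polyX map_polyC hornerXsubC mulrBl divfK // -mul_mpolyC.
by rewrite rmorphM.
Qed.

End RootsOfUnity.

(** * The decomposition *)

(** Labels are needed because ideals, being predicates, cannot be compared. *)
Variant component (K : fieldType) :=
  | CompC | CompAlpha of K | CompSF | CompB4 | CompCB | CompEmbedded.

Definition component_code (K : fieldType) (l : component K) : option K * nat :=
  match l with
  | CompC => (None, 0%N) | CompAlpha a => (Some a, 0%N) | CompSF => (None, 1%N)
  | CompB4 => (None, 2%N) | CompCB => (None, 3%N) | CompEmbedded => (None, 4%N)
  end.

Definition component_decode (K : fieldType) (c : option K * nat) : component K :=
  match c with
  | (Some a, _) => CompAlpha a | (None, 0%N) => CompC K | (None, 1%N) => CompSF K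
  | (None, 2%N) => CompB4 K | (None, 3%N) => CompCB K | _ => CompEmbedded K
  end.

Lemma component_codeK (K : fieldType) :
  cancel (@component_code K) (@component_decode K).
Proof. by case. Qed.

HB.instance Definition _ (K : fieldType) :=
  Equality.copy (component K) (can_type (@component_codeK K)).

Section Decomposition.
Variables (K : fieldType) (d i : nat) (alphas : seq K).
Hypotheses (d_gt0 : (0 < d)%N) (i_gt0 : (0 < i)%N) (pchar_i : [pchar K].-nat i).
Hypothesis uniq_alphas : uniq alphas.
Hypothesis alpha_root : {in alphas, forall a, exists g, g ^+ i = a /\ g ^+ d = 1}.
Hypothesis prod_alphas :
  \prod_(a <- alphas) (b1 ^+ i - a *: b2 ^+ i) = b1 ^+ d - b2 ^+ d :> {mpoly K[12]}.
Implicit Types (x y z : {mpoly K[12]}) (a g : K).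

Local Notation J := (@mayr_meyer_ideal K d).
Local Notation bin a := (b1 ^+ i - a *: b2 ^+ i).
Local Notation rho := (subst (alpha_elim K d)).

Definition point (l : seq K) (k : 'I_12) : K := nth 0 l k.

(** A zero of the component of alpha = g^i, provided that g^d = 1. *)
Definition alpha_point g := point [:: 1; 1; 1; 1; 1; 1; 1; 1; g; 1; 1; g].

Local Ltac vanishing :=
  apply: radical_gen_meval; rewrite /= -?mul_mpolyC; subst_simp; rewrite ?mevalC /point /=.

Lemma comp_c_zero x : radical (@comp_c K) x ->
  x.@[point [:: 1; 0; 0; 0; 0; 0; 0; 0; 0; 1]] = 0.
Proof. by vanishing; rewrite !mulr0 subrr. Qed.

Lemma comp_alpha_zero g a x : g ^+ i = a -> g ^+ d = 1 ->
  radical (@comp_alpha K d i a) x -> x.@[alpha_point g] = 0.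
Proof.
by move=> ga gd; vanishing; rewrite ga gd expr1n !mulr1 !subrr.
Qed.

Lemma comp_sf_zero x : radical (@comp_sf K) x ->
  x.@[point [:: 0; 0; 0; 0; 1; 0; 0; 0; 0; 1]] = 0.
Proof. by vanishing; rewrite !mul0r subrr. Qed.

Lemma comp_b4_zero x : radical (@comp_b4 K d) x ->
  x.@[point [:: 0; 1; 0; 0; 0; 0; 1; 0; 0; 1]] = 0.
Proof. by vanishing; rewrite !mul0r subrr expr0n gtn_eqF. Qed.

Lemma comp_cb_zero x : radical (@comp_cb K d) x ->
  x.@[point [:: 0; 1; 0; 0; 0; 1]] = 0.
Proof. by vanishing; rewrite !(mul0r, mulr0) subrr expr0n gtn_eqF. Qed.

Lemma alpha_primary a : a \in alphas -> primary_ideal (@comp_alpha K d i a).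
Proof. by move=> /alpha_root[g [<- _]]; apply: comp_alpha_primary. Qed.

Lemma delta_comp_alpha a : a \in alphas -> @comp_alpha K d i a (b1 ^+ d - b2 ^+ d).
Proof.
move=> aa; rewrite -prod_alphas (big_rem a) //=.
have idQ : is_ideal (@comp_alpha K d i a) := @ideal_gen_ideal _ _.
have G : all_in (@comp_alpha K d i a) _ := @ideal_gen_gens _ _.
by move: G => /= [_ [_ [_ [_ [_ [_ [_ [_ [G9 _]]]]]]]]]; apply: ideal_mulr.
Qed.

Lemma rho_rho x : rho (rho x) = rho x.
Proof. by apply: subst_comp => k; elim/ord12_ind: k; subst_simp. Qed.

(** The binomials b1^i - alpha b2^i are powers of pairwise non-associate primes,
    hence a common multiple is a multiple of their product; each is cancelled
    from the others because it does not vanish at their zeros. *)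
Lemma alpha_common_multiple z : {in alphas, forall a, @comp_alpha K d i a z} ->
  exists q, rho z = (b1 ^+ d - b2 ^+ d) * rho q.
Proof.
move=> Qz; rewrite -prod_alphas.
have rho_bin a : rho (bin a) = bin a by rewrite -!mul_mpolyC; subst_simp.
suff main as_ : uniq as_ -> {subset as_ <= alphas} ->
    exists q, rho z = (\prod_(a <- as_) bin a) * rho q by exact: main.
elim: as_ => [|a as_ IH] /=; first by exists z; rewrite big_nil mul1r.
move=> /andP[a_as u_as] sub_as.
have aa : a \in alphas by apply: sub_as; exact: mem_head.
have [|q Eq] := IH u_as; first by move=> b bas; apply: sub_as; rewrite inE bas orbT.
have [g [ga gd]] := alpha_root aa.
have Qrq : @comp_alpha K d i a (rho q).
  apply: (primary_cancel (alpha_primary aa) (fun y => @comp_alpha_zero g a y ga gd)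
    (a := \prod_(b <- as_) bin b)).
    rewrite rmorph_prod prodf_seq_neq0; apply/allP => b bas /=.
    rewrite -mul_mpolyC; subst_simp; rewrite mevalC /alpha_point /point /=.
    rewrite ga expr1n mulr1 subr_eq0; apply: contraNneq a_as => ->.
    by rewrite bas.
  by apply/comp_alphaE; rewrite -Eq rho_rho; apply/comp_alphaE; apply: Qz.
have [t /subr0_eq Et] := (comp_alphaE d i a (rho q)).1 Qrq.
exists t; rewrite Eq big_cons -[rho q]rho_rho; rewrite rho_rho in Et.
by rewrite [in LHS]Et rmorphM /= rho_bin; ring.
Qed.

Lemma J_sub_c x : J x -> comp_c x.
Proof.
have idQ : is_ideal (@comp_c K) := @ideal_gen_ideal _ _.
have G : all_in (@comp_c K) _ := @ideal_gen_gens _ _.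
move: G => /= [G1 [G2 [G3 [G4 [G5 [G6 _]]]]]].
by apply: ideal_gen_sub => //; conj_split=> //; in_ideal idQ.
Qed.

Lemma J_sub_sf x : J x -> comp_sf x.
Proof.
have idQ : is_ideal (@comp_sf K) := @ideal_gen_ideal _ _.
have G : all_in (@comp_sf K) _ := @ideal_gen_gens _ _.
move: G => /= [G1 [G2 [G3 [G4 _]]]].
by apply: ideal_gen_sub => //; conj_split=> //; in_ideal idQ.
Qed.

Lemma J_sub_b4 x : J x -> comp_b4 d x.
Proof.
have idQ : is_ideal (@comp_b4 K d) := @ideal_gen_ideal _ _.
have G : all_in (@comp_b4 K d) _ := @ideal_gen_gens _ _.
move: G => /= [G1 [G2 [G3 [G4 [G5 [G6 [G7 [G8 _]]]]]]]].
by apply: ideal_gen_sub => //; conj_split=> //; in_ideal idQ.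
Qed.

Lemma comp_cb_b2 : comp_cb d (b2 ^+ d : {mpoly K[12]}).
Proof.
have idQ : is_ideal (@comp_cb K d) := @ideal_gen_ideal _ _.
have G : all_in (@comp_cb K d) _ := @ideal_gen_gens _ _.
move: G => /= [_ [_ [_ [_ [_ [G6 [G7 _]]]]]]].
by apply/(ideal_iffB idQ (ideal_exprB idQ d G7)).
Qed.

Lemma J_sub_cb x : J x -> comp_cb d x.
Proof.
have idQ : is_ideal (@comp_cb K d) := @ideal_gen_ideal _ _.
have G : all_in (@comp_cb K d) _ := @ideal_gen_gens _ _.
have Gb2 := comp_cb_b2.
move: G => /= [G1 [G2 [G3 [G4 [G5 [G6 [G7 [G8 _]]]]]]]].
by apply: ideal_gen_sub => //; conj_split=> //; in_ideal idQ.
Qed.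

Lemma J_sub_alpha a x : a \in alphas -> J x -> comp_alpha d i a x.
Proof.
move=> /delta_comp_alpha D.
have idQ : is_ideal (@comp_alpha K d i a) := @ideal_gen_ideal _ _.
have G : all_in (@comp_alpha K d i a) _ := @ideal_gen_gens _ _.
move: G => /= [G1 [G2 [G3 [G4 [G5 [G6 [G7 [G8 [G9 _]]]]]]]]].
have D14 := ideal_exprB idQ d G7; have D23 := ideal_exprB idQ d G8.
have S2 : comp_alpha d i a (s - f * b2 ^+ d).
  apply: (ideal_comb idQ (l := [:: (1, _); (f, _)])).
    by split; [exact: G6|split; [exact: D|]].
  by comb_ring.
have S3 : comp_alpha d i a (s - f * b3 ^+ d).
  apply: (ideal_comb idQ (l := [:: (1, _); (f, _)])).
    by split; [exact: S2|split; [exact: D23|]].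
  by comb_ring.
have S4 : comp_alpha d i a (s - f * b4 ^+ d).
  apply: (ideal_comb idQ (l := [:: (1, _); (f, _)])).
    by split; [exact: G6|split; [exact: D14|]].
  by comb_ring.
have A1 : comp_alpha d i a (f * c1 - s * c2).
  apply: (ideal_comb idQ (l := [:: (f, _); (- c2, _)])).
    by split; [exact: G5|split; [exact: G6|]].
  by comb_ring.
have A2 : comp_alpha d i a (f * c4 - s * c3).
  apply: (ideal_comb idQ (l := [:: (f, _); (1, _); (- s, _)])).
    by split; [exact: G3|split; [exact: A1|split; [exact: G4|]]].
  by comb_ring.
have A4 : comp_alpha d i a (c2 * b1 - c3 * b4).
  apply: (ideal_comb idQ (l := [:: (c2, _); (- b4, _)])).
    by split; [exact: G7|split; [exact: G4|]].
  by comb_ring.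
apply: (ideal_gen_sub idQ); split; first exact: G1.
split; first exact: G2.
split; first exact: (ideal_mull idQ _ G6).
split; first exact: (ideal_mull idQ _ S2).
split; first exact: (ideal_mull idQ _ S3).
split; first exact: (ideal_mull idQ _ S4).
split; first exact: A1.
split; first exact: A2.
split; first exact: (ideal_mull idQ _ G4).
split; first exact: (ideal_mull idQ _ A4).
by split; first exact: (ideal_mull idQ _ G8).
Qed.

Lemma J_sub_embedded x : J x -> comp_embedded d x.
Proof.
have idQ : is_ideal (@comp_embedded K d) := @ideal_gen_ideal _ _.
have G : all_in (@comp_embedded K d) _ := @ideal_gen_gens _ _.
move: G => /= [G1 [G2 [_ [_ [G4 [G3 [Gsc [_ [_ [E1 [E2 [E3 [E4 _]]]]]]]]]]]]].
have D14 := ideal_exprB idQ d E4; have D23 := ideal_exprB idQ d E3.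
apply: (ideal_gen_sub idQ); split; first exact: G1.
split; first exact: G2.
split.
  apply: (ideal_comb idQ (l := [:: (s - f * b1 ^+ d, _); (1, _); (- (c4 * f), _)])).
      by split; [exact: E1|split; [exact: G4|split; [exact: D14|]]].
    by comb_ring.
split.
  apply: (ideal_comb idQ (l := [:: (s - f * b2 ^+ d, _); (1, _); (- (c3 * f), _)])).
      by split; [exact: E2|split; [exact: G3|split; [exact: D23|]]].
    by comb_ring.
split; first exact: G3.
split; first exact: G4.
split.
  apply: (ideal_comb idQ (l := [:: (f, _); (- s, _); (-1, _)])).
      by split; [exact: E1|split; [exact: E2|split; [exact: Gsc|]]].
    by comb_ring.
split.
  by apply: (ideal_comb idQ (l := [:: (-1, _)])); [split; [exact: Gsc|]|comb_ring].
split.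
  by apply: (ideal_comb idQ (l := [:: (- s, _)])); [split; [exact: E2|]|comb_ring].
split.
  apply: (ideal_comb idQ (l := [:: (f * b1, _); (f * c3, _)])).
      by split; [exact: E2|split; [exact: E4|]].
    by comb_ring.
by split; first exact: (ideal_mull idQ _ E3).
Qed.

(** The four reductions bring an element of all components to the form
    f c2 b2^d (f y1 + c2 y2) modulo J; membership in the components indexed by
    roots of unity then makes f y1 + c2 y2 a multiple of b1^d - b2^d. *)
Lemma intersection_sub x :
  comp_c x -> {in alphas, forall a, comp_alpha d i a x} ->
  comp_sf x -> comp_b4 d x -> comp_cb d x -> comp_embedded d x -> J x.
Proof.
move=> Qc Qa Qsf Qb4 Qcb Qemb; have idJ := J_ideal K d.
have idb4 : is_ideal (@comp_b4 K d) := @ideal_gen_ideal _ _.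
have idcb : is_ideal (@comp_cb K d) := @ideal_gen_ideal _ _.
have [_ [_ [_ [_ [b4c2 _]]]]] : all_in (@comp_b4 K d) _ := @ideal_gen_gens _ _.
have {Qc Qsf} [z [y Jx]] := reduce_c_sf d Qc Qsf.
have Ax : adjoin J (f * c2) x.
  have idA := adjoin_is_ideal (f * c2) idJ.
  suff /reduce_b4 Az : comp_b4 d z.
    rewrite -[x](subrK (z * (f * c3))); apply: idealD => //; first by exists y.
    by rewrite [z * _]mulrC.
  apply: (primary_cancel (comp_b4_primary K d_gt0) (@comp_b4_zero) (a := f * c3)).
    by subst_simp; rewrite mulr1 oner_neq0.
  apply: (ideal_comb idb4 (l := [:: (1, _); (-1, _); (- (y * f), _)])).
    by split; [exact: Qb4|split; [exact: (J_sub_b4 Jx)|split; [exact: b4c2|]]].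
  by comb_ring.
have {z y Jx Ax} [y Jx] := Ax.
have Bx : adjoin J (f * c2 * b2 ^+ d) x.
  have idB := adjoin_is_ideal (f * c2 * b2 ^+ d) idJ.
  suff /reduce_cb By : comp_cb d y.
    rewrite -[x](subrK (y * (f * c2))); apply: idealD => //; first exact: adjoin_incl.
    by rewrite [y * _]mulrC.
  apply: (primary_cancel (comp_cb_primary K d_gt0) (@comp_cb_zero) (a := f * c2)).
    by subst_simp; rewrite mulr1 oner_neq0.
  by rewrite mulrC; apply/(ideal_iffB idcb (J_sub_cb Jx)).
have {y Jx Bx} [y Jx] := Bx; set e := f * c2 * b2 ^+ d in Jx.
have Cx : adjoin (adjoin J (e * f)) (e * c2) x.
  have idC : is_ideal (adjoin (adjoin J (e * f)) (e * c2)).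
    by do 2!apply: adjoin_is_ideal.
  suff /(reduce_emb d) Cy : subst (emb_const K) y = 0.
    rewrite -[x](subrK (y * e)); apply: idealD => //; first by do 2!apply: adjoin_incl.
    by rewrite [y * _]mulrC.
  have Qfc2 : comp_embedded d (f * c2 * (b2 ^+ d * y)).
    have -> : f * c2 * (b2 ^+ d * y) = x - (x - y * e) by rewrite /e; ring.
    by apply: (idealB (comp_embedded_ideal K d)) => //; apply: J_sub_embedded.
  have /eqP := comp_embedded_fc2 Qfc2; subst_simp.
  by rewrite mulf_eq0 expf_eq0 (negbTE (mpolyX_neq0 _ _)) andbF => /eqP.
have {y Jx Cx} [y2 [y1 Jx]] := Cx.
have [|q Eq] := @alpha_common_multiple (f * y1 + c2 * y2).
  move=> a aa; have [g [ga gd]] := alpha_root aa.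
  apply: (primary_cancel (alpha_primary aa) (fun y => @comp_alpha_zero g a y ga gd)
    (a := e)).
    by rewrite /e; subst_simp; rewrite /alpha_point /point /= expr1n !mulr1 oner_neq0.
  have -> : e * (f * y1 + c2 * y2) = x - (x - y2 * (e * c2) - y1 * (e * f)) by ring.
  apply: idealB; [exact: ideal_gen_ideal|exact: Qa|exact: J_sub_alpha].
(* reduce modulo f and c2, which do not divide b1^d - b2^d *)
have [r2 [r1 /subr0_eq Er]] : adjoin (adjoin (@zero_ideal _) f) c2 (rho q).
  pose v : 12.-tuple {mpoly K[12]} :=
    [tuple of [:: s; 0; s1; f1; c1; 0; c3; c4; b1; b2; b3; b4]].
  have idz : is_ideal (adjoin (adjoin (@zero_ideal {mpoly K[12]}) f) c2).
    by do 2!apply: adjoin_is_ideal; exact: zero_is_ideal.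
  have v0 : subst v (rho q) = 0.
    have lhs0 : subst v (rho (f * y1 + c2 * y2)) = 0.
      rewrite rmorphD !rmorphM /= !substX /= rmorphD !rmorphM /= !substX /=.
      by rewrite !mul0r addr0.
    have /eqP := congr1 (subst v) Eq; rewrite lhs0 rmorphM rmorphB !rmorphXn /= !substX /=.
    rewrite eq_sym mulf_eq0.
    case/orP=> /eqP //.
    move/(congr1 (meval (point [:: 0; 0; 0; 0; 0; 0; 0; 0; 1]))); subst_simp.
    rewrite /point /= expr1n expr0n gtn_eqF // subr0 => /eqP.
    by rewrite oner_eq0.
  rewrite -[rho q]subr0 -v0 -[X in adjoin _ _ X]mul1r; apply: subst_congr => // k.
  rewrite mul1r; elim/ord12_ind: k; rewrite /= ?subrr ?subr0; try exact: (ideal0 idz).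
  - by apply: adjoin_incl; apply: adjoin_gen; exact: zero_is_ideal.
  - by apply: adjoin_gen; apply: adjoin_is_ideal; exact: zero_is_ideal.
move: Eq; rewrite rmorphD !rmorphM /= !substX /= => Eq.
have Er' : rho q = r2 * c2 + r1 * f by rewrite -[LHS](subrK (r2 * c2)) Er addrC.
apply: (ideal_comb idJ (l := [:: (1, _); (1, _); (1, _); (r1, _); (r2, _)])).
  split; first exact: Jx.
  split; first exact: (reduce_alpha d (or_introl erefl) y1).
  split; first exact: (reduce_alpha d (or_intror erefl) y2).
  split; first exact: (J_fc2_f K d).
  by split; first exact: (J_fc2_c2 K d).
rewrite !(big_cons, big_nil) /=.
have Ee : e * (f * rho y1 + c2 * rho y2) =
    r1 * (e * f * (b1 ^+ d - b2 ^+ d)) + r2 * (e * c2 * (b1 ^+ d - b2 ^+ d)).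
  by rewrite Eq Er'; ring.
rewrite -/e addr0 -Ee; ring.
Qed.

Definition comp (l : component K) : {mpoly K[12]} -> Prop :=
  match l with
  | CompC => @comp_c K
  | CompAlpha a => comp_alpha d i a
  | CompSF => @comp_sf K
  | CompB4 => @comp_b4 K d
  | CompCB => @comp_cb K d
  | CompEmbedded => @comp_embedded K d
  end.

Definition components : seq (component K) :=
  CompC K :: [seq CompAlpha a | a <- alphas]
  ++ [:: CompSF K; CompB4 K; CompCB K; CompEmbedded K].

(** Products of generators chosen to lie in every component but l. *)
Definition separator (l : component K) : {mpoly K[12]} :=
  match l with
  | CompC => s * s * (b2 - b3)
  | CompAlpha a => s * s * c1 * \prod_(b <- alphas | b != a) bin b
  | CompSF => c1 * c1 * (b2 - b3)
  | CompB4 => f * c3 * c3 * (b2 - b3)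
  | CompCB => f * f * c2 * (c3 - c2)
  | CompEmbedded => f * c2 * (b2 ^+ d * (b1 ^+ d - b2 ^+ d))
  end.

Lemma componentsE : mayr_meyer_components d i alphas = [seq comp l | l <- components].
Proof. by rewrite /mayr_meyer_components /= map_cat -map_comp. Qed.

Lemma mem_alpha a : (CompAlpha a \in components) = (a \in alphas).
Proof.
rewrite inE mem_cat !inE /= orbF mem_map // => x y; by case.
Qed.

Lemma uniq_components : uniq components.
Proof.
have not_alpha l : (forall a, l != CompAlpha a) -> (l \in [seq CompAlpha a | a <- alphas]) = false.
  by move=> la; apply/mapP => -[a _ E]; have := la a; rewrite E eqxx.
rewrite /components cons_uniq cat_uniq mem_cat /= !not_alpha //=.
by rewrite map_inj_uniq ?uniq_alphas // => x y [].
Qed.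

Lemma separator_mem l m : l \in components -> m \in components -> l != m ->
  comp m (separator l).
Proof.
move=> ll mm; have idQ : is_ideal (comp m) by case: m {mm} => *; exact: ideal_gen_ideal.
case: m idQ mm => [|a|||| ] idQ mm lm /=; simpl in idQ.
- have [_ [_ [G3 [G4 [G5 [G6 _]]]]]] : all_in (@comp_c K) _ := @ideal_gen_gens _ _.
  by case: l ll lm => [|b|||| ] ll lm /=; try (by rewrite eqxx in lm); in_ideal idQ.
- rewrite mem_alpha in mm; have D := delta_comp_alpha mm.
  have [_ [_ [_ [G4 [_ [_ [_ [G8 [G9 _]]]]]]]]] :
    all_in (@comp_alpha K d i a) _ := @ideal_gen_gens _ _.
  case: l ll lm => [|b|||| ] ll lm /=; try (by in_ideal idQ).
  have ab : a != b by apply: contraNneq lm => ->.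
  apply: (ideal_mull idQ); rewrite (big_rem a) //= ab; exact: (ideal_mulr idQ).
- have [_ [_ [G3 [G4 _]]]] : all_in (@comp_sf K) _ := @ideal_gen_gens _ _.
  by case: l ll lm => [|b|||| ] ll lm /=; try (by rewrite eqxx in lm); in_ideal idQ.
- have [_ [_ [G3 [G4 [G5 _]]]]] : all_in (@comp_b4 K d) _ := @ideal_gen_gens _ _.
  by case: l ll lm => [|b|||| ] ll lm /=; try (by rewrite eqxx in lm); in_ideal idQ.
- have [_ [_ [G3 [G4 [_ [_ [G7 _]]]]]]] : all_in (@comp_cb K d) _ := @ideal_gen_gens _ _.
  have Gb2 := comp_cb_b2.
  by case: l ll lm => [|b|||| ] ll lm /=; try (by rewrite eqxx in lm); in_ideal idQ.
- have [_ [_ [G3 [G4 [_ [_ [_ [_ [_ [_ [_ [G12 _]]]]]]]]]]]] :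
    all_in (@comp_embedded K d) _ := @ideal_gen_gens _ _.
  rewrite expr2 in G3; rewrite expr2 in G4.
  by case: l ll lm => [|b|||| ] ll lm /=; try (by rewrite eqxx in lm); in_ideal idQ.
Qed.

(** Each of these components has a zero at which its separator does not vanish. *)
Lemma separator_not_radical l : l \in components -> l != CompEmbedded K ->
  ~ radical (comp l) (separator l).
Proof.
case: l => [|a|||| ] ll le; rewrite /separator.
- move/comp_c_zero; subst_simp; rewrite /point /= subr0 !mulr1 => /eqP.
  by rewrite oner_eq0.
- rewrite mem_alpha in ll; have [g [ga gd]] := alpha_root ll.
  move/(comp_alpha_zero ga gd) => /eqP; apply/negP.
  subst_simp; rewrite rmorph_prod /= /alpha_point /point /= !mul1r.
  rewrite prodf_seq_neq0; apply/allP => b _; apply/implyP => ba.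
  rewrite -mul_mpolyC; subst_simp; rewrite mevalC /= ga expr1n mulr1 subr_eq0.
  by rewrite eq_sym.
- move/comp_sf_zero; subst_simp; rewrite /point /= subr0 !mulr1 => /eqP.
  by rewrite oner_eq0.
- move/comp_b4_zero; subst_simp; rewrite /point /= subr0 !mulr1 => /eqP.
  by rewrite oner_eq0.
- move/comp_cb_zero; subst_simp; rewrite /point /= sub0r mulrN !mulr1 => /eqP.
  by rewrite oppr_eq0 oner_eq0.
- by rewrite eqxx in le.
Qed.

(** Modulo the component this separator is the nonzero coefficient
    b2^d (b1^d - b2^d) times a basis element. *)
Lemma separator_embedded : ~ comp_embedded d (separator (CompEmbedded K)).
Proof.
move=> /= /comp_embedded_fc2; subst_simp.
move=> /(congr1 (meval (point [:: 0; 0; 0; 0; 0; 0; 0; 0; 0; 1]))); subst_simp.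
rewrite /point /= expr1n expr0n gtn_eqF // sub0r mul1r => /eqP.
by rewrite oppr_eq0 oner_eq0.
Qed.

Lemma decomposition :
  minimal_primary_decomposition J (mayr_meyer_components d i alphas).
Proof.
rewrite componentsE.
apply: (minimal_primary_of_separating (e := CompEmbedded K) (sep := separator)).
- exact: uniq_components.
- case=> [|a|||| ] /=; rewrite ?mem_alpha => // ll.
  + exact: comp_c_primary.
  + exact: alpha_primary.
  + exact: comp_sf_primary.
  + exact: comp_b4_primary.
  + exact: comp_cb_primary.
  + exact: comp_embedded_primary.
- move=> x; split=> [Jx|Qx].
    case=> [|a|||| ] /=; rewrite ?mem_alpha => ll.
    + exact: J_sub_c.
    + exact: J_sub_alpha.
    + exact: J_sub_sf.
    + exact: J_sub_b4.
    + exact: J_sub_cb.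
    + exact: J_sub_embedded.
  have mem l : l \in [:: CompC K; CompSF K; CompB4 K; CompCB K; CompEmbedded K] ->
      l \in components.
    by rewrite /components !inE mem_cat !inE => /orP[->|->]; rewrite ?orbT.
  apply: intersection_sub.
  + by apply: (Qx (CompC K)); apply: mem.
  + by move=> a aa; apply: (Qx (CompAlpha a)); rewrite mem_alpha.
  + by apply: (Qx (CompSF K)); apply: mem.
  + by apply: (Qx (CompB4 K)); apply: mem.
  + by apply: (Qx (CompCB K)); apply: mem.
  + by apply: (Qx (CompEmbedded K)); apply: mem.
- by move=> l m ll mm; apply: separator_mem.
- move=> l ll; have [->|le] := eqVneq l (CompEmbedded K).
    exact: separator_embedded.
  by move=> Ql; apply: (separator_not_radical ll le); exists 0%N.
- exact: separator_not_radical.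
Qed.

End Decomposition.

Theorem theorem1 (K : fieldType) (d d' i : nat) (hd : (0 < d)%N)
    (hdi : char_factorization K d d' i)
    (hsplit : exists zs : seq K, 'X^d' - 1 = \prod_(z <- zs) ('X - z%:P))
    (alphas : seq K) (halphas_uniq : uniq alphas)
    (halphas : forall a : K, (a \in alphas) = d'.-unity_root a) :
  minimal_primary_decomposition (@mayr_meyer_ideal K d)
    (mayr_meyer_components d i alphas).
Proof.
have [dE cop d'K pi] := char_factorizationP hd hdi.
have [d'_gt0 i_gt0] : (0 < d')%N /\ (0 < i)%N.
  by move: hd; rewrite dE muln_gt0 => /andP.
apply: decomposition => //.
- move=> a; rewrite halphas => /unity_rootP ad.
  have [g ga] := unity_root_exp i_gt0 cop ad.
  by exists g; split; rewrite // dE mulnC exprM ga.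
- rewrite (@prod_unity_roots_homog K 12 d' alphas _ _ d'_gt0) ?dE 1?mulnC ?exprM //.
    by rewrite expf_neq0 // mpolyX_neq0.
  exact: prod_unity_roots.
Qed.
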